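(* Let $k$ be a subfield of $\mathbf{C}$, let $A$ be a locally finite graded set with an operation $[\cdot,\cdot]$ on $\bar A=A\cup\{0\}$ satisfying (S0)–(S3), and let $\mathfrak{A}=k\langle A\rangle$ with graded dual $\mathfrak{A}^*$. There is a Hopf algebra isomorphism $\exp^*$ (the transpose of $\exp$) from $(\mathfrak{A}^*,\mathrm{conc},\delta')$ to $(\mathfrak{A}^*,\mathrm{conc},\delta)$.
   Context: $A$ is a graded set, $A=\bigsqcup_{n\ge1}A_n$ with each $A_n$ (the elements of degree $n$) finite; elements of $A$ are called letters and $|a|$ is the degree of a letter $a$. $\mathfrak{A}=k\langle A\rangle$ is the $k$-vector space of noncommutative polynomials in the letters, with basis the words (monomials) in the letters, including the empty word $1$. Juxtaposition denotes concatenation. $\ell(w)$ is the number of letters of a word $w$; its degree is the sum of the degrees of its letters, and $\mathfrak{A}_n$ is the (finite-dimensional) span of the words of degree $n$. Let $\bar A=A\cup\{0\}$ and let $[\cdot,\cdot]:\bar A\times\bar A\to\bar A$ be a function satisfying: (S0) $[a,0]=0$ for all $a\in\bar A$; (S1) $[a,b]=[b,a]$ for all $a,b\in\bar A$; (S2) $[[a,b],c]=[a,[b,c]]$ for all $a,b,c\in\bar A$; (S3) for all $a,b\in A$, either $[a,b]=0$ or $|[a,b]|=|a|+|b|$. The quasi-shuffle product $*$ is the $k$-bilinear operation on $\mathfrak{A}$ defined recursively on words by $1*w=w*1=w$ and $aw_1*bw_2=a(w_1*bw_2)+b(aw_1*w_2)+[a,b](w_1*w_2)$ for letters $a,b$ and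 words $w_1,w_2$. The shuffle product $ш$ is defined by the same recursion with the last term omitted. With $\Delta(w)=\sum_{uv=w}u\otimes v$ (deconcatenation) and the counit sending $1$ to $1$ and nonempty words to $0$, $(\mathfrak{A},ш,\Delta)$ and $(\mathfrak{A},*,\Delta)$ are graded Hopf algebras. For a nonempty finite sequence of letters define $[a]=a$ and $[a_1,a_2,\dots,a_m]=[a_1,[a_2,\dots,a_m]]\in\bar A$. $\mathcal{C}(n)$ is the set of compositions $(i_1,\dots,i_l)$ of $n$ (sequences of positive integers with sum $n$). For a word $w=a_1\cdots a_n$ and $I=(i_1,\dots,i_l)\in\mathcal{C}(n)$, set $I[w]=[a_1,\dots,a_{i_1}][a_{i_1+1},\dots,a_{i_1+i_2}]\cdots[a_{i_1+\dots+i_{l-1}+1},\dots,a_n]$ (which is $0$ if any bracket is $0$). The linear map $\exp:\mathfrak{A}\to\mathfrak{A}$ is defined by $\exp(1)=1$ and $\exp(w)=\sum_{(i_1,\dots,i_l)\in\mathcal{C}(\ell(w))}\frac{1}{i_1!\cdots i_l!}(i_1,\dots,i_l)[w]$ for nonempty words $w$. The graded dual is $\mathfrak{A}^*=\bigoplus_{n\ge0}\mathfrak{A}_n^*$, with basis $\{w^*\}$ dual to the words: $(u,v^* )=1$ if $u=v$ and $0$ otherwise. On $\mathfrak{A}^*$: $\mathrm{conc}(u^*\otimes v^* )=(uv)^*$; $\delta(w^* )=\sum_{u,v}(u\,ш\,v,w^* )\,u^*\otimes v^*$; $\delta'(w^* )=\sum_{u,v}(u*v,w^* )\,u^*\otimes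 v^*$ (sums over all words $u,v$). $(\mathfrak{A}^*,\mathrm{conc},\delta)$ and $(\mathfrak{A}^*,\mathrm{conc},\delta')$ are the Hopf algebras graded-dual to $(\mathfrak{A},ш,\Delta)$ and $(\mathfrak{A},*,\Delta)$ respectively. The transpose $\exp^*:\mathfrak{A}^*\to\mathfrak{A}^*$ is defined by $(u,\exp^*(f))=(\exp(u),f)$ for $u\in\mathfrak{A}$, $f\in\mathfrak{A}^*$. *)

(* Defs.v *)
From HB Require Import structures.
From mathcomp Require Import all_boot all_order all_algebra finmap.
From mathcomp Require Import boolp classical_sets cardinality fsbigop reals.
From mathcomp.real_closed Require Import complex.
From mathcomp.multinomials Require Import monalg.

Set Implicit Arguments.
Unset Strict Implicit.
Unset Printing Implicit Defensive.

Import GRing.Theory.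

Local Open Scope classical_set_scope.
Local Open Scope ring_scope.

(* Vector spaces with a basis.  {malg k[B]} is the k-vector space with basis  *)
(* the elements <<b>>, b : B.  Its tensor product with {malg k[C]} is         *)
(* {malg k[B * C]}, the pure tensor of <<b>> and <<c>> being <<(b, c)>>.      *)

Section Linext.
Variables (k : fieldType) (B : choiceType) (M : lmodType k).

Definition linext (F : B -> M) (x : {malg k[B]}) : M :=
  \sum_(b <- msupp x) x@_b *: F b.

Lemma linextEw (F : B -> M) (x : {malg k[B]}) (d : {fset B}) :
  (msupp x `<=` d)%fset -> linext F x = \sum_(b <- d) x@_b *: F b.
Proof.
move=> sxd; rewrite /linext (big_fset_incl _ sxd) // => b _ bx.
by rewrite mcoeff_outdom // scale0r.
Qed.

Fact linext_is_linear (F : B -> M) : linear (linext F).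
Proof.
move=> a x y; pose d := (msupp x `|` msupp y `|` msupp (a *: x + y))%fset.
have [dx dy dz] : [/\ msupp x `<=` d, msupp y `<=` d
                    & msupp (a *: x + y)%R `<=` d]%fset.
  split; apply/fsubsetP => b; rewrite /d !in_fsetU => ->; rewrite ?orbT //.
rewrite (linextEw F dx) (linextEw F dy) (linextEw F dz).
rewrite scaler_sumr -big_split /=; apply: eq_bigr => b _.
by rewrite mcoeffD mcoeffZ scalerDl scalerA.
Qed.

HB.instance Definition _ (F : B -> M) :=
  GRing.isLinear.Build k {malg k[B]} M _ (linext F) (linext_is_linear F).

Lemma linextU (F : B -> M) b : linext F << b >> = F b.
Proof. by rewrite /linext msuppU oner_eq0 big_seq_fset1 mcoeffUU scale1r. Qed.

End Linext.

Section Tensor.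
Variable k : fieldType.

Definition tens (B C : choiceType) (x : {malg k[B]}) (y : {malg k[C]}) :
    {malg k[(B * C)%type]} :=
  linext (fun b => linext (fun c => << (b, c) >>) y) x.

Definition tmap (B B' C C' : choiceType)
    (f : {malg k[B]} -> {malg k[B']}) (g : {malg k[C]} -> {malg k[C']}) :
    {malg k[(B * C)%type]} -> {malg k[(B' * C')%type]} :=
  linext (fun p => tens (f << p.1 >>) (g << p.2 >>)).

Definition tassoc (B C D : choiceType) :
    {malg k[(B * C * D)%type]} -> {malg k[(B * (C * D))%type]} :=
  linext (fun p => << (p.1.1, (p.1.2, p.2)) >>).

(* x (x) y (x) z (x) t |-> x (x) z (x) y (x) t *)
Definition tswap (B C D E : choiceType) :
    {malg k[((B * C) * (D * E))%type]} -> {malg k[((B * D) * (C * E))%type]} :=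
  linext (fun p => << ((p.1.1, p.2.1), (p.1.2, p.2.2)) >>).

End Tensor.

Record hopf_ops (k : fieldType) (B : choiceType) := HopfOps {
  hmul : {linear {malg k[(B * B)%type]} -> {malg k[B]}};
  hone : {malg k[B]};
  hcomul : {linear {malg k[B]} -> {malg k[(B * B)%type]}};
  hcounit : {linear {malg k[B]} -> k^o}
}.

Section Hopf.
Variable k : fieldType.

Definition is_algebra (B : choiceType) (H : hopf_ops k B) : Prop :=
  [/\ forall t, hmul H (tmap (hmul H) idfun t)
                = hmul H (tmap idfun (hmul H) (tassoc t)),
      forall x, hmul H (tens (hone H) x) = x
    & forall x, hmul H (tens x (hone H)) = x].

Definition is_coalgebra (B : choiceType) (H : hopf_ops k B) : Prop :=
  [/\ forall x, tassoc (tmap (hcomul H) idfun (hcomul H x))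
                = tmap idfun (hcomul H) (hcomul H x),
      forall x, linext (fun p : B * B => hcounit H << p.1 >> *: << p.2 >>)
                  (hcomul H x) = x
    & forall x, linext (fun p : B * B => hcounit H << p.2 >> *: << p.1 >>)
                  (hcomul H x) = x].

Definition is_bialgebra (B : choiceType) (H : hopf_ops k B) : Prop :=
  [/\ is_algebra H,
      is_coalgebra H,
      (forall t, hcomul H (hmul H t)
         = tmap (hmul H) (hmul H) (tswap (tmap (hcomul H) (hcomul H) t)))
        /\ hcomul H (hone H) = tens (hone H) (hone H)
    & (forall x y, hcounit H (hmul H (tens x y)) = hcounit H x * hcounit H y)
        /\ hcounit H (hone H) = 1].

Definition is_antipode (B : choiceType) (H : hopf_ops k B)
    (S : {linear {malg k[B]} -> {malg k[B]}}) : Prop :=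
  forall x, hmul H (tmap S idfun (hcomul H x)) = hcounit H x *: hone H
         /\ hmul H (tmap idfun S (hcomul H x)) = hcounit H x *: hone H.

Definition is_hopf_algebra (B : choiceType) (H : hopf_ops k B) : Prop :=
  is_bialgebra H /\ exists S, is_antipode H S.

Record hopf_morphism (B C : choiceType) (H : hopf_ops k B) (K : hopf_ops k C)
    (f : {linear {malg k[B]} -> {malg k[C]}}) : Prop := HopfMorphism {
  hm_mul : forall t, f (hmul H t) = hmul K (tmap f f t);
  hm_one : f (hone H) = hone K;
  hm_comul : forall x, hcomul K (f x) = tmap f f (hcomul H x);
  hm_counit : forall x, hcounit K (f x) = hcounit H x;
  hm_antipode : forall S T, is_antipode H S -> is_antipode K T ->
                forall x, f (S x) = T (f x)
}.

Definition hopf_isomorphism (B C : choiceType)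
    (H : hopf_ops k B) (K : hopf_ops k C)
    (f : {linear {malg k[B]} -> {malg k[C]}}) : Prop :=
  [/\ is_hopf_algebra H, is_hopf_algebra K, hopf_morphism H K f & bijective f].

End Hopf.

(* Words are elements of the free monoid {fmonom A}, a wrapper around seq A.  *)
(* ncpoly k A is k<A>; its library ring product is the concatenation product. *)
Notation ncpoly k A := {malg k[{fmonom A}]} (only parsing).

(* The graded dual of k<A>, identified with the vector space on the dual      *)
(* basis: << w >> in gdual k A stands for w^*, and gdual k A acts on k<A>     *)
(* through pairing below.  The identification is justified by gdual_pairing   *)
(* and gdual_representable.                                                   *)
Notation gdual k A := {malg k[{fmonom A}]} (only parsing).

Section QuasiShuffle.
Variables (k : fieldType) (A : choiceType).

Local Notation W := {fmonom A}.

Definition letter (a : A) : {malg k[W]} := << FMonom [:: a] >>.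

(* option A is the set A with a zero adjoined, None being the zero. *)
Definition oletter (x : option A) : {malg k[W]} :=
  if x is Some a then letter a else 0.

Fixpoint sh_seq (u : seq A) : seq A -> {malg k[W]} :=
  match u with
  | [::] => fun v => << FMonom v >>
  | a :: u' =>
      fix sh_u (v : seq A) : {malg k[W]} :=
        match v with
        | [::] => << FMonom u >>
        | b :: v' => letter a * sh_seq u' v + letter b * sh_u v'
        end
  end.

Definition shuffle (u v : W) : {malg k[W]} := sh_seq u v.

Variable br : option A -> option A -> option A.

Fixpoint qsh_seq (u : seq A) : seq A -> {malg k[W]} :=
  match u with
  | [::] => fun v => << FMonom v >>
  | a :: u' =>
      fix qsh_u (v : seq A) : {malg k[W]} :=
        match v with
        | [::] => << FMonom u >>
        | b :: v' => letter a * qsh_seq u' v + letter b * qsh_u v'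
                     + oletter (br (Some a) (Some b)) * qsh_seq u' v'
        end
  end.

Definition quasi_shuffle (u v : W) : {malg k[W]} := qsh_seq u v.

(* [a_1, ..., a_m]; the value at the empty sequence is never used. *)
Fixpoint brackets (s : seq A) : option A :=
  match s with
  | [::] => None
  | a :: s' => if s' is [::] then Some a else br (Some a) (brackets s')
  end.

Definition compositions (n : nat) : set (seq nat) :=
  [set I | all (fun i => 0 < i)%N I /\ sumn I = n].

Definition comp_act (I : seq nat) (w : W) : {malg k[W]} :=
  \prod_(s <- reshape I w) oletter (brackets s).

(* At the empty word the only composition is the empty one: exp 1 = 1. *)
Definition exp_word (w : W) : {malg k[W]} :=
  \sum_(I \in compositions (size w))
    (\prod_(i <- I) i`!%:R)^-1 *: comp_act I w.

Definition qexp : {malg k[W]} -> {malg k[W]} := linext exp_word.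

Definition pairing (x : ncpoly k A) (f : gdual k A) : k :=
  \sum_(w <- msupp x) x@_w * f@_w.

Definition is_transpose (phi : ncpoly k A -> ncpoly k A)
    (psi : gdual k A -> gdual k A) : Prop :=
  forall u f, pairing u (psi f) = pairing (phi u) f.

Definition dual_conc : {malg k[(W * W)%type]} -> {malg k[W]} :=
  linext (fun p : W * W => << mmul p.1 p.2 >> : {malg k[W]}).

(* The coproduct on the graded dual transposed from a product m on words.     *)
Definition dual_coprod (m : W -> W -> {malg k[W]}) :
    {malg k[W]} -> {malg k[(W * W)%type]} :=
  linext (fun w => \sum_(p \in [set: (W * W)%type])
                     pairing (m p.1 p.2) << w >> *: << p >>).

(* The transpose of the unit 1 |-> 1 of k<A>. *)
Definition dual_counit : {malg k[W]} -> k^o :=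
  linext (fun w => pairing << mone >> << w >> : k^o).

HB.instance Definition _ := GRing.Linear.on dual_conc.
HB.instance Definition _ m := GRing.Linear.on (dual_coprod m).
HB.instance Definition _ := GRing.Linear.on dual_counit.

Definition dual_hopf (m : W -> W -> {malg k[W]}) : hopf_ops k W :=
  HopfOps dual_conc << mone >> (dual_coprod m) dual_counit.

End QuasiShuffle.

(* The sums over all words in dual_coprod are finite, and gdual is the graded *)
(* dual: the space of linear forms on k<A> vanishing in all large degrees.    *)
Section Grading.
Variables (k : fieldType) (A : choiceType) (deg : A -> nat).
Hypothesis deg_gt0 : forall a : A, (0 < deg a)%N.
Hypothesis A_finite : forall n : nat, finite_set [set a : A | deg a = n].
Local Notation W := {fmonom A}.

Definition wdeg (w : seq A) : nat := sumn (map deg w).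

Lemma finite_wdeg_le (n : nat) : finite_set [set w : W | (wdeg w <= n)%N].
Proof.
suff H : finite_set [set s : seq A | (wdeg s <= n)%N].
  apply: (@sub_finite_set _ _ ((@FMonom A) @` [set s | (wdeg s <= n)%N])).
    by move=> [s] /= sn; exists s.
  exact: finite_image.
elim: n => [|n IHn].
  apply: (@sub_finite_set _ _ [set [::]]); last exact: finite_set1.
  move=> [|a s] //=; rewrite /wdeg /= leqn0 addn_eq0 => /andP[/eqP a0].
  by have := deg_gt0 a; rewrite a0.
have Ln : finite_set [set a | (deg a <= n.+1)%N].
  apply: (@sub_finite_set _ _ (\bigcup_(i in `I_n.+2) [set a | deg a = i])).
    by move=> a /= an; exists (deg a).
  by apply: bigcup_finite => // i _; exact: A_finite.
apply: (@sub_finite_set _ _ ([set [::]] `|`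
  [set a :: s | a in [set a | (deg a <= n.+1)%N]
              & s in [set s | (wdeg s <= n)%N]])).
  move=> [|a s] /=; first by left.
  rewrite /wdeg /= => h; right; exists a; first exact: leq_trans (leq_addr _ _) h.
  exists s => //=; rewrite -ltnS; apply: leq_trans h.
  by rewrite -add1n leq_add2r.
by rewrite finite_setU; split; [exact: finite_set1 | exact: finite_image2].
Qed.

Definition homogeneous (n : nat) (x : {malg k[W]}) : Prop :=
  forall w, w \in msupp x -> wdeg w = n.

Lemma homogeneousU (w : W) : homogeneous (wdeg w) << w >>.
Proof. by move=> w'; rewrite msuppU oner_eq0 inE => /eqP ->. Qed.

Lemma homogeneousD n x y :
  homogeneous n x -> homogeneous n y -> homogeneous n (x + y).
Proof.
by move=> hx hy w /(fsubsetP (msuppD_le _ _)); rewrite in_fsetU => /orP[/hx|/hy].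
Qed.

Lemma homogeneousM m n x y :
  homogeneous m x -> homogeneous n y -> homogeneous (m + n) (x * y).
Proof.
move=> hx hy w /msuppM_le[w1 [w2 [/hx <- /hy <- ->]]].
by rewrite /wdeg fmM map_cat sumn_cat.
Qed.

Lemma homogeneous_letter (a : A) : homogeneous (deg a) (letter k a).
Proof. by move=> w /homogeneousU ->; rewrite /wdeg /= addn0. Qed.

Definition graded_product (m : W -> W -> {malg k[W]}) : Prop :=
  forall u v : W, homogeneous (wdeg u + wdeg v) (m u v).

Lemma graded_shuffle : graded_product (@shuffle k A).
Proof.
move=> [u] [v]; rewrite /shuffle /=.
elim: u v => [|a u IHu] v; first by move=> w; move: (@homogeneousU (FMonom v) w).
elim: v => [|b v IHv].
  by move=> w /(@homogeneousU (FMonom (a :: u))) ->; rewrite addn0.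
apply: homogeneousD.
  rewrite -[wdeg (a :: u)]/(deg a + wdeg u)%N -addnA.
  exact: homogeneousM (@homogeneous_letter a) (IHu _).
rewrite -[wdeg (b :: v)]/(deg b + wdeg v)%N addnCA.
exact: homogeneousM (@homogeneous_letter b) IHv.
Qed.

Lemma graded_quasi_shuffle (br : option A -> option A -> option A) :
  (forall a b : A, br (Some a) (Some b) = None \/
     exists2 c : A, br (Some a) (Some b) = Some c
                  & deg c = (deg a + deg b)%N) ->
  graded_product (@quasi_shuffle k A br).
Proof.
move=> S3 [u] [v]; rewrite /quasi_shuffle /=.
elim: u v => [|a u IHu] v; first by move=> w; move: (@homogeneousU (FMonom v) w).
elim: v => [|b v IHv].
  by move=> w /(@homogeneousU (FMonom (a :: u))) ->; rewrite addn0.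
apply: homogeneousD; first apply: homogeneousD.
- rewrite -[wdeg (a :: u)]/(deg a + wdeg u)%N -addnA.
  exact: homogeneousM (@homogeneous_letter a) (IHu _).
- rewrite -[wdeg (b :: v)]/(deg b + wdeg v)%N addnCA.
  exact: homogeneousM (@homogeneous_letter b) IHv.
case: (S3 a b) => [->|[c -> dc]]; first by move=> w; rewrite mul0r msupp0.
rewrite -[wdeg (a :: u)]/(deg a + wdeg u)%N -[wdeg (b :: v)]/(deg b + wdeg v)%N.
rewrite addnACA -dc.
exact: homogeneousM (@homogeneous_letter c) (IHu _).
Qed.

Lemma pairingU (x : ncpoly k A) (w : W) : pairing x << w >> = x@_w.
Proof.
rewrite /pairing; case: (boolP (w \in msupp x)) => wx.
  rewrite (big_fsetD1 w) //= mcoeffUU mulr1 big1_fset ?addr0 // => v.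
  by rewrite !inE => /andP[/negPf vw _] _; rewrite mcoeffU eq_sym vw mulr0.
rewrite mcoeff_outdom // big1_fset // => v vx _.
rewrite mcoeffU; case: eqP => [wv|_]; last by rewrite mulr0.
by rewrite wv vx in wx.
Qed.

Lemma pairingUl (w : W) (f : gdual k A) : pairing << w >> f = f@_w.
Proof. by rewrite /pairing msuppU oner_eq0 big_seq_fset1 mcoeffUU mul1r. Qed.

Lemma dual_coprodE (m : W -> W -> {malg k[W]}) : graded_product m ->
  forall u v w : W, (dual_coprod m << w >>)@_(u, v) = pairing (m u v) << w >>.
Proof.
move=> gm u v w; rewrite /dual_coprod linextU.
set F := fun p : W * W => pairing (m p.1 p.2) << w >> *: << p >> :
  {malg k[(W * W)%type]}.
have finF : finite_set ([set: (W * W)%type] `&` F @^-1` [set~ 0]).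
  pose D := [set x : W | (wdeg x <= wdeg w)%N].
  apply: (@sub_finite_set _ _ (D `*` D)); last first.
    by apply: finite_setX; exact: finite_wdeg_le.
  move=> [x y] [_] /=; rewrite /F pairingU /= => Fxy.
  have [wm|wm] := boolP (w \in msupp (m x y)); last first.
    by case: Fxy; rewrite mcoeff_outdom // scale0r.
  by rewrite /D /= (gm _ _ _ wm) leq_addr leq_addl.
have E p : (F p)@_(u, v) = pairing (m u v) << w >> *+ (p == (u, v)).
  rewrite /F mcoeffZ mcoeffU.
  by case: eqP => [->|_]; rewrite ?mulr1 // mulr0.
rewrite raddf_sum (eq_bigr (fun p => pairing (m u v) << w >> *+ (p == (u, v))));
  last by move=> p _; exact: E.
clearbody F.
have [uvF|uvF] := boolP ((u, v) \in finite_support 0 [set: (W * W)%type] F).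
  rewrite (bigD1_seq (u, v)) ?finite_support_uniq //= eqxx big1 ?addr0 // => p.
  by move=> /negPf ->.
rewrite big_seq big1 => [|p pF]; last first.
  by case: eqP => // pE; rewrite -pE pF in uvF.
apply/esym/eqP; apply: contraNT uvF => nz.
rewrite in_finite_support // inE; split => //= /(congr1 (mcoeff (u, v))).
by rewrite E eqxx mcoeff0 => /eqP; apply/negP.
Qed.

Lemma gdual_pairing (f : gdual k A) :
  exists n, forall w : W, (n < wdeg w)%N -> pairing << w >> f = 0.
Proof.
exists (\max_(w <- msupp f) wdeg w)%N => w; rewrite pairingUl.
case: (boolP (w \in msupp f)) => [wf|/mcoeff_outdom //].
by rewrite ltnNge (leq_bigmax_seq w wf).
Qed.

Lemma gdual_representable (phi : {linear ncpoly k A -> k^o}) (n : nat) :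
  (forall w : W, (n < wdeg w)%N -> phi << w >> = 0) ->
  exists! f : gdual k A, forall x, phi x = pairing x f.
Proof.
move=> phi0.
pose f : gdual k A := [malg w in fset_set [set w : W | (wdeg w <= n)%N]
                         => phi << w >>].
have fE w : f@_w = phi << w >>.
  rewrite mcoeffE; case: ifPn => //.
  rewrite in_fset_set; last exact: finite_wdeg_le.
  by rewrite notin_setE /= => /negP; rewrite -ltnNge => /phi0 ->.
exists f; split=> [x|g gE].
  rewrite {1}(monalgE x) raddf_sum /pairing; apply: eq_bigr => w _.
  rewrite fE -[RHS]/(x@_w *: (phi << w >>)) -linearZ; congr (phi _).
  by apply/malgP => v; rewrite mcoeffZ !mcoeffU mulrnAr mulr1.
by apply/malgP => w; rewrite fE gE pairingUl.
Qed.

End Grading.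

(* Main.v *)
(* The dual of the (quasi-)shuffle product is a coproduct on the free algebra
   (gdual, conc) which is multiplicative for concatenation, with
     delta'(c) = c (x) 1 + 1 (x) c + sum_([a, b] = c) a (x) b
   on letters, so coassociativity and compatibility with a multiplicative map
   need only be checked on letters.  For the shuffle the letters are primitive,
   and w |-> (-1)^|w| rev w is an antipode.  The transpose of exp is the
   multiplicative map f with f(c) = sum_([w] = c) w / |w|!.  By commutativity of
   [.,.] all words of u sh v have the same bracket as uv, and there are
   binomial(|u| + |v|, |u|) of them, so the coefficient of u (x) v in delta(f(c))
   is 1 / (|u|! |v|!) if [uv] = c and 0 otherwise; this is the coefficient in
   (f (x) f)(delta'(c)).  Moreover f(w) - w involves only words of the same
   degree as w with more letters, so f - id is locally nilpotent and f is
   bijective.  The Hopf structure of (gdual, conc, delta') is carried over from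
   the shuffle side through f. *)

From HB Require Import structures.
Require Import Defs.
From mathcomp Require Import all_boot all_order all_algebra finmap.
From mathcomp Require Import boolp classical_sets cardinality fsbigop reals.
From mathcomp.real_closed Require Import complex.
From mathcomp.multinomials Require Import monalg.

Import GRing.Theory Num.Theory.

Local Open Scope classical_set_scope.
Local Open Scope ring_scope.

(** * Linear extensions and tensors *)

Section LinearExtension.
Set Implicit Arguments.
Unset Strict Implicit.
Context {k : fieldType}.

Lemma malgUZ (B : choiceType) (a : k) (b : B) :
  << a *g b >> = a *: << b >> :> {malg k[B]}.
Proof. by apply/malgP => c; rewrite mcoeffZ !mcoeffU mulrnAr mulr1. Qed.

Lemma malg_ind (B : choiceType) (P : {malg k[B]} -> Prop) :
  P 0 -> (forall a x y, P x -> P y -> P (a *: x + y)) ->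
  (forall b, P << b >>) -> forall x, P x.
Proof.
move=> P0 PD PU x; rewrite (monalgE x).
elim/big_rec: _ => [//|b y _ Py].
rewrite malgUZ; exact: PD.
Qed.

(** Multilinear identities are reduced to basis elements by this lemma, one variable at a time; the
    [f] and [g] given at each use exhibit both sides as linear maps of the variable being
    treated. *)
Lemma linear_malg_ext (B : choiceType) (M : lmodType k)
    (f g : {linear {malg k[B]} -> M}) :
  (forall b, f << b >> = g << b >>) -> f =1 g.
Proof.
move=> fg; elim/malg_ind => [|a x y fx fy|//]; first by rewrite !linear0.
by rewrite !linearP fx fy.
Qed.

Lemma eq_linext (B : choiceType) (M : lmodType k) (F G : B -> M) :
  F =1 G -> linext F =1 linext G.
Proof. by move=> FG; apply: linear_malg_ext => b /=; rewrite !linextU FG. Qed.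

Lemma linear_linext (B : choiceType) (M N : lmodType k) (f : {linear M -> N})
    (F : B -> M) x : f (linext F x) = linext (fun b => f (F b)) x.
Proof.
by elim/malg_ind: x => [|a x y fx fy|b]; rewrite ?linear0 ?linearP ?fx ?fy ?linextU.
Qed.

Lemma mcoeff_linext (B C : choiceType) (F : B -> {malg k[C]}) x c :
  (linext F x)@_c = linext (fun b => (F b)@_c : k^o) x.
Proof.
elim/malg_ind: x => [|a x y fx fy|b]; rewrite ?linear0 ?mcoeff0 //.
  by rewrite !linearP mcoeffD mcoeffZ fx fy.
by rewrite !linextU.
Qed.

Lemma linext0 (B : choiceType) (M : lmodType k) (F : B -> M) : linext F 0 = 0.
Proof. exact: linear0. Qed.

Lemma linextP (B : choiceType) (M : lmodType k) (F : B -> M) a x y :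
  linext F (a *: x + y) = a *: linext F x + linext F y.
Proof. exact: linearP. Qed.

Lemma tens0l (B C : choiceType) (y : {malg k[C]}) :
  tens (0 : {malg k[B]}) y = 0.
Proof. exact: linext0. Qed.

Lemma tensPl (B C : choiceType) a (x x' : {malg k[B]}) (y : {malg k[C]}) :
  tens (a *: x + x') y = a *: tens x y + tens x' y.
Proof. exact: linextP. Qed.

Lemma tens_is_linear (B C : choiceType) (x : {malg k[B]}) :
  linear (@tens k B C x).
Proof.
move=> a y z; elim/malg_ind: x => [|b u v Hu Hv|b].
- by rewrite !tens0l scaler0 addr0.
- rewrite tensPl Hu Hv !tensPl (scalerDr a) (scalerDr b) [LHS]addrACA.
  by rewrite !(scalerA b) !(scalerA a) (mulrC b).
- by rewrite /tens !linextU linextP.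
Qed.
HB.instance Definition _ (B C : choiceType) (x : {malg k[B]}) :=
  GRing.isLinear.Build k {malg k[C]} {malg k[(B * C)%type]} _
    (@tens k B C x) (@tens_is_linear B C x).

HB.instance Definition _ (B B' C C' : choiceType)
    (f : {malg k[B]} -> {malg k[B']}) (g : {malg k[C]} -> {malg k[C']}) :=
  GRing.Linear.on (@tmap k B B' C C' f g).
HB.instance Definition _ (B C D : choiceType) :=
  GRing.Linear.on (@tassoc k B C D).
HB.instance Definition _ (B C D E : choiceType) :=
  GRing.Linear.on (@tswap k B C D E).

(* tens x is canonically linear in its second argument; tensr y := tens^~ y
   carries the linear structure in the first one. *)
Definition tensr (B C : choiceType) (y : {malg k[C]}) (x : {malg k[B]}) :=
  tens x y.
HB.instance Definition _ (B C : choiceType) (y : {malg k[C]}) :=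
  GRing.isLinear.Build k {malg k[B]} {malg k[(B * C)%type]} _
    (@tensr B C y) (fun a x x' => tensPl a x x' y).

Lemma tensUU (B C : choiceType) (b : B) (c : C) :
  tens << b >> << c >> = << (b, c) >> :> {malg k[(B * C)%type]}.
Proof. by rewrite /tens !linextU. Qed.

Lemma mcoeff_tens (B C : choiceType) (x : {malg k[B]}) (y : {malg k[C]}) b c :
  (tens x y)@_(b, c) = x@_b * y@_c.
Proof.
rewrite /tens mcoeff_linext [in RHS](monalgE x) raddf_sum mulr_suml.
apply: eq_bigr => b' _ /=; rewrite mcoeff_linext -[LHS]/(_ * _).
rewrite mcoeffU; case: (eqVneq b' b) => [->|nb]; last first.
  rewrite mul0r /linext big1 ?mulr0 // => c' _.
  by rewrite mcoeffU xpair_eqE (negPf nb) scaler0.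
congr (_ * _); rewrite [in RHS](monalgE y) raddf_sum; apply: eq_bigr => c' _ /=.
by rewrite !mcoeffU xpair_eqE eqxx -[LHS]/(_ * _) mulrnAr mulr1.
Qed.

(** [is_coalgebra] states the left counit law through this contraction; its value on pure tensors is
    what transporting that law along a morphism requires. *)
Lemma linext_tensl (B C : choiceType) (e : {linear {malg k[B]} -> k^o})
    (x : {malg k[B]}) (y : {malg k[C]}) :
  linext (fun p : B * C => e << p.1 >> *: << p.2 >>) (@tens k B C x y) = e x *: y.
Proof.
pose L : {linear {malg k[(B * C)%type]} -> {malg k[C]}} :=
  linext (k := k) (fun p : B * C => (e << p.1 >> : k) *: << p.2 >>).
rewrite -[LHS]/(L _).
pose s z : {malg k[B]} -> {malg k[C]} := fun x => (e x : k) *: z.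
have s_lin z : linear (s z).
  by move=> a u v; rewrite /s (linearP e) scalerDl [RHS]/= scalerA.
pose sz z : {linear _ -> _} :=
  HB.pack (s z) (GRing.isLinear.Build _ _ _ _ (s z) (s_lin z)).
move: x; apply: (linear_malg_ext (f := L \o tensr y) (g := sz y)) => b /=.
move: y; apply: (linear_malg_ext (f := L \o tens << b >>)
                                 (g := *:%R (e << b >> : k))) => c /=.
by rewrite tensUU /L linextU.
Qed.

Lemma linext_tensr (B C : choiceType) (e : {linear {malg k[C]} -> k^o})
    (x : {malg k[B]}) (y : {malg k[C]}) :
  linext (fun p : B * C => e << p.2 >> *: << p.1 >>) (@tens k B C x y) = e y *: x.
Proof.
pose L : {linear {malg k[(B * C)%type]} -> {malg k[B]}} :=
  linext (k := k) (fun p : B * C => (e << p.2 >> : k) *: << p.1 >>).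
rewrite -[LHS]/(L _).
pose s z : {malg k[C]} -> {malg k[B]} := fun x => (e x : k) *: z.
have s_lin z : linear (s z).
  by move=> a u v; rewrite /s (linearP e) scalerDl [RHS]/= scalerA.
pose sz z : {linear _ -> _} :=
  HB.pack (s z) (GRing.isLinear.Build _ _ _ _ (s z) (s_lin z)).
move: y; apply: (linear_malg_ext (f := L \o tens x) (g := sz x)) => c /=.
move: x; apply: (linear_malg_ext (f := L \o tensr << c >>)
                                 (g := *:%R (e << c >> : k))) => b /=.
by rewrite /tensr tensUU /L linextU.
Qed.

Section Tmap.
Variables B B' C C' : choiceType.
Variables (f : {malg k[B]} -> {malg k[B']}) (g : {malg k[C]} -> {malg k[C']}).

Lemma tmapU p : tmap f g << p >> = tens (f << p.1 >>) (g << p.2 >>).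
Proof. exact: linextU. Qed.

End Tmap.

Lemma tmap_tens (B B' C C' : choiceType)
    (f : {linear {malg k[B]} -> {malg k[B']}})
    (g : {linear {malg k[C]} -> {malg k[C']}}) x y :
  tmap f g (tens x y) = tens (f x) (g y).
Proof.
move: x; apply: (linear_malg_ext (f := tmap f g \o tensr y)
                                 (g := tensr (g y) \o f)) => b /=.
move: y; apply: (linear_malg_ext (f := tmap f g \o tens << b >>)
                                 (g := tens (f << b >>) \o g)) => c /=.
by rewrite tensUU tmapU.
Qed.

Lemma eq_tmap (B B' C C' : choiceType)
    (f f' : {malg k[B]} -> {malg k[B']}) (g g' : {malg k[C]} -> {malg k[C']}) :
  f =1 f' -> g =1 g' -> tmap f g =1 tmap f' g'.
Proof. by move=> ff' gg'; apply: eq_linext => p; rewrite ff' gg'. Qed.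

(** The inner maps may be arbitrary functions because [tmap] only evaluates them at basis
    elements. *)
Lemma tmap_comp (B B' B'' C C' C'' : choiceType)
    (f' : {linear {malg k[B']} -> {malg k[B'']}})
    (g' : {linear {malg k[C']} -> {malg k[C'']}})
    (f : {malg k[B]} -> {malg k[B']}) (g : {malg k[C]} -> {malg k[C']}) t :
  tmap f' g' (tmap f g t) = tmap (f' \o f) (g' \o g) t.
Proof.
by rewrite [LHS]linear_linext; apply: eq_linext => p; apply: tmap_tens.
Qed.

Lemma tmap_id (B C : choiceType) :
  tmap idfun idfun =1 @idfun {malg k[(B * C)%type]}.
Proof. by apply: linear_malg_ext => -[b c]; rewrite /= tmapU tensUU. Qed.

Lemma tassocU (B C D : choiceType) b c d :
  @tassoc k B C D << (b, c, d) >> = << (b, (c, d)) >>.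
Proof. exact: linextU. Qed.

Lemma tassoc_tens (B C D : choiceType) (x : {malg k[B]}) (y : {malg k[C]})
    (z : {malg k[D]}) :
  tassoc (tens (tens x y) z) = tens x (tens y z).
Proof.
move: x; apply: (linear_malg_ext (f := @tassoc k B C D \o tensr z \o tensr y)
                                 (g := tensr (tens y z))) => b /=.
move: y; apply: (linear_malg_ext
    (f := @tassoc k B C D \o tensr z \o tens << b >>)
    (g := tens << b >> \o tensr z)) => c /=.
move: z; apply: (linear_malg_ext
    (f := @tassoc k B C D \o tens (tens << b >> << c >>))
    (g := tens << b >> \o tens << c >>)) => d /=.
by rewrite /tensr !tensUU tassocU.
Qed.

Lemma tassoc_tmap (B B' C C' D D' : choiceType)
    (f : {malg k[B]} -> {malg k[B']}) (g : {malg k[C]} -> {malg k[C']})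
    (h : {malg k[D]} -> {malg k[D']}) t :
  tassoc (tmap (tmap f g) h t) = tmap f (tmap g h) (tassoc t).
Proof.
move: t; apply: (linear_malg_ext (f := @tassoc k _ _ _ \o tmap (tmap f g) h)
  (g := tmap f (tmap g h) \o @tassoc k _ _ _)) => -[[b c] d] /=.
by rewrite tassocU !tmapU tassoc_tens.
Qed.

Lemma tswapU (B C D E : choiceType) b c d e :
  @tswap k B C D E << ((b, c), (d, e)) >> = << ((b, d), (c, e)) >>.
Proof. exact: linextU. Qed.

End LinearExtension.

(** * Convolution and transport of Hopf structures *)

Section HopfTheory.
Set Implicit Arguments.
Unset Strict Implicit.
Context {k : fieldType}.

Definition convolution (B C : choiceType) (H : hopf_ops k B)
    (K : hopf_ops k C) (f g : {malg k[B]} -> {malg k[C]}) x :=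
  hmul K (tmap f g (hcomul H x)).

Definition conv_unit (B C : choiceType) (H : hopf_ops k B) (K : hopf_ops k C)
    (x : {malg k[B]}) : {malg k[C]} :=
  hcounit H x *: hone K.

Fact conv_unit_is_linear (B C : choiceType) (H : hopf_ops k B)
    (K : hopf_ops k C) : linear (conv_unit H K).
Proof.
by move=> a x y; rewrite /conv_unit (linearP (hcounit H)) scalerDl -scalerA.
Qed.
HB.instance Definition _ (B C : choiceType) (H : hopf_ops k B)
    (K : hopf_ops k C) :=
  GRing.isLinear.Build k {malg k[B]} {malg k[C]} _ (conv_unit H K)
    (conv_unit_is_linear H K).

Section Convolution.
Variables (B C : choiceType) (H : hopf_ops k B) (K : hopf_ops k C).
Hypotheses (coalgH : is_coalgebra H) (algK : is_algebra K).

(** Both sides are threefold convolutions: coassociativity of [H] rebrackets the input and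
    associativity of [K] the output. *)
Lemma convolutionA (f g h : {linear {malg k[B]} -> {malg k[C]}}) :
  convolution H K (convolution H K f g) h
  =1 convolution H K f (convolution H K g h).
Proof.
case: coalgH algK => coA _ _ [mA _ _] x; rewrite /convolution.
set t := hcomul H x.
have -> : tmap (fun y => hmul K (tmap f g (hcomul H y))) h t
  = tmap (hmul K) idfun (tmap (tmap f g) h (tmap (hcomul H) idfun t)).
  by rewrite [X in tmap (hmul K) _ X]tmap_comp [RHS]tmap_comp.
have -> : tmap f (fun y => hmul K (tmap g h (hcomul H y))) t
  = tmap idfun (hmul K) (tmap f (tmap g h) (tmap idfun (hcomul H) t)).
  by rewrite [X in tmap _ (hmul K) X]tmap_comp [RHS]tmap_comp.
by rewrite mA tassoc_tmap coA.
Qed.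

Lemma convolution_unitl (f : {linear {malg k[B]} -> {malg k[C]}}) :
  convolution H K (conv_unit H K) f =1 f.
Proof.
case: coalgH algK => _ cu _ [_ mu _] x; rewrite /convolution.
(* The counit law expands [x] on the right, so both sides become linear extensions evaluated at
   [hcomul H x] and can be compared on basis pairs. *)
rewrite -[in RHS](cu x) [LHS]linear_linext [RHS]linear_linext.
apply: eq_linext => p /=; rewrite /conv_unit.
by rewrite -[tens _ _]/(tensr _ _) linearZ_LR linearZ_LR /tensr mu linearZ_LR.
Qed.

Lemma convolution_unitr (f : {linear {malg k[B]} -> {malg k[C]}}) :
  convolution H K f (conv_unit H K) =1 f.
Proof.
case: coalgH algK => _ _ cu [_ _ mu] x; rewrite /convolution.
rewrite -[in RHS](cu x) [LHS]linear_linext [RHS]linear_linext.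
apply: eq_linext => p /=; rewrite /conv_unit.
by rewrite !linearZ_LR mu.
Qed.

Lemma eq_convolution (f f' g g' : {malg k[B]} -> {malg k[C]}) :
  f =1 f' -> g =1 g' -> convolution H K f g =1 convolution H K f' g'.
Proof. by move=> ff' gg' x; rewrite /convolution (eq_tmap ff' gg'). Qed.

(** A left and a right inverse in a monoid agree: writing . for convolution, g = g.(f.h) = (g.f).h =
    h. *)
Lemma convolution_inverse_unique (f g h : {linear {malg k[B]} -> {malg k[C]}}) :
  convolution H K g f =1 conv_unit H K ->
  convolution H K f h =1 conv_unit H K -> g =1 h.
Proof.
move=> gf fh x; rewrite -[LHS]convolution_unitr -[RHS]convolution_unitl.
by rewrite -(eq_convolution (frefl g) fh) -(eq_convolution gf (frefl h))
           convolutionA.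
Qed.

End Convolution.

(** * Bialgebra morphisms, and transport of structure along an invertible one *)

Section BialgebraMorphism.
Variables (B C : choiceType) (H : hopf_ops k B) (K : hopf_ops k C).
Variable f : {linear {malg k[B]} -> {malg k[C]}}.
Hypothesis f_mul : forall t, f (hmul H t) = hmul K (tmap f f t).
Hypothesis f_one : f (hone H) = hone K.
Hypothesis f_comul : forall x, hcomul K (f x) = tmap f f (hcomul H x).
Hypothesis f_counit : forall x, hcounit K (f x) = hcounit H x.

(** Both [f \o S] and [T \o f] are convolution inverses of [f], the first on the left and the second
    on the right. *)
Lemma bialgebra_morphism_antipode (S : {linear {malg k[B]} -> {malg k[B]}})
    (T : {linear {malg k[C]} -> {malg k[C]}}) :
  is_coalgebra H -> is_algebra K -> is_antipode H S -> is_antipode K T ->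
  forall x, f (S x) = T (f x).
Proof.
move=> coH aK antS antT.
apply: (convolution_inverse_unique (f := f) (g := f \o S) (h := T \o f)
          coH aK) => x; rewrite /convolution /conv_unit.
  have [SE _] := antS x; rewrite -f_one -linearZ -SE f_mul.
  by rewrite [X in _ = hmul K X]tmap_comp.
have [_ TE] := antT (f x); rewrite -f_counit -TE f_comul.
by rewrite [X in _ = hmul K X]tmap_comp.
Qed.

Variable g : {linear {malg k[C]} -> {malg k[B]}}.
Hypotheses (fK : cancel f g) (gK : cancel g f).

(** The second factor is left general so that f (x) (f (x) f), needed for coassociativity, is
    covered. *)
Let tmap_f_inj (B' C' : choiceType)
    (f' : {linear {malg k[B']} -> {malg k[C']}})
    (g' : {linear {malg k[C']} -> {malg k[B']}}) :
  cancel f' g' -> injective (tmap f f').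
Proof.
move=> f'K; apply: (can_inj (g := tmap g g')) => t.
by rewrite tmap_comp (eq_tmap fK f'K) tmap_id.
Qed.

Lemma is_coalgebra_transport : is_coalgebra K -> is_coalgebra H.
Proof.
case=> coA cul cur; split=> x.
- have tfK : cancel (tmap f f) (tmap g g).
    by move=> t; rewrite tmap_comp (eq_tmap fK fK) tmap_id.
  apply: (tmap_f_inj tfK); rewrite -tassoc_tmap.
  have -> : tmap (tmap f f) f (tmap (hcomul H) idfun (hcomul H x))
          = tmap (hcomul K) idfun (tmap f f (hcomul H x)).
    rewrite [LHS]tmap_comp [RHS]tmap_comp.
    by apply: eq_tmap => y //=; rewrite f_comul.
  have -> : tmap f (tmap f f) (tmap idfun (hcomul H) (hcomul H x))
          = tmap idfun (hcomul K) (tmap f f (hcomul H x)).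
    rewrite [LHS]tmap_comp [RHS]tmap_comp.
    by apply: eq_tmap => y //=; rewrite f_comul.
  by rewrite -f_comul coA.
- apply: (can_inj fK); rewrite -[RHS]cul f_comul [LHS]linear_linext.
  rewrite [RHS]linear_linext; apply: eq_linext => -[b c] /=.
  by rewrite linext_tensl f_counit linearZ.
- apply: (can_inj fK); rewrite -[RHS]cur f_comul [LHS]linear_linext.
  rewrite [RHS]linear_linext; apply: eq_linext => -[b c] /=.
  by rewrite linext_tensr f_counit linearZ.
Qed.

(** The antipode of [K] is conjugated by [f]; its two identities are checked after applying the
    injective map [f]. *)
Lemma has_antipode_transport :
  (exists T, is_antipode K T) -> exists S, is_antipode H S.
Proof.
move=> [T antT]; exists (g \o T \o f) => x.
have [TE1 TE2] := antT (f x); split; apply: (can_inj fK).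
  rewrite f_mul linearZ /= f_one -f_counit -TE1 f_comul.
  congr (hmul K _); rewrite [LHS]tmap_comp [RHS]tmap_comp.
  by apply: eq_tmap => y //=; rewrite gK.
rewrite f_mul linearZ /= f_one -f_counit -TE2 f_comul.
congr (hmul K _); rewrite [LHS]tmap_comp [RHS]tmap_comp.
by apply: eq_tmap => y //=; rewrite gK.
Qed.

End BialgebraMorphism.

End HopfTheory.

(** * Monoid algebras and their tensor products *)

Section ProductMonoid.
Variables M N : monomType.

(** With the componentwise monoid structure on pairs of words, the tensor square of the free algebra
    is itself a monoid algebra. It thereby gets its ring structure, and coproducts can be treated as
    ring morphisms. *)
Local Definition prod_mone : M * N := (mone, mone).
Local Definition prod_mmul (p q : M * N) : M * N :=
  (mmul p.1 q.1, mmul p.2 q.2).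

Fact prod_mmulA : associative prod_mmul.
Proof. by move=> [? ?] [? ?] [? ?]; rewrite /prod_mmul /= !mulmA. Qed.

Fact prod_mul1m : left_id prod_mone prod_mmul.
Proof. by move=> [? ?]; rewrite /prod_mmul /= !mul1m. Qed.

Fact prod_mulm1 : right_id prod_mone prod_mmul.
Proof. by move=> [? ?]; rewrite /prod_mmul /= !mulm1. Qed.

Fact prod_unitm p q : prod_mmul p q = prod_mone -> p = prod_mone /\ q = prod_mone.
Proof. by case: p q => [? ?] [? ?] [/unitm[-> ->] /unitm[-> ->]]. Qed.

HB.instance Definition _ := Choice_isMonomialDef.Build (M * N)%type
  prod_mmulA prod_mul1m prod_mulm1 prod_unitm.
End ProductMonoid.

Section MonoidAlgebra.
Set Implicit Arguments.
Unset Strict Implicit.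
Context {k : fieldType}.

Lemma malgU1 (M : monomType) : << mone >> = 1 :> {malg k[M]}.
Proof. by rewrite -mpolyC1E. Qed.

Lemma malg_mulUU (M : monomType) (b c : M) :
  << b >> * << c >> = << mmul b c >> :> {malg k[M]}.
Proof. by rewrite malgM_def fgmulUU mulr1. Qed.

(* The library makes {malg k[M]} an algebra only for commutative M; lmul and
   rmul record that its product is bilinear. *)
Definition lmul (M : monomType) (x y : {malg k[M]}) := x * y.
Definition rmul (M : monomType) (y x : {malg k[M]}) := x * y.

Fact lmul_is_linear (M : monomType) (x : {malg k[M]}) : linear (lmul x).
Proof.
move=> a y z; rewrite /lmul mulrDr; congr (_ + _).
apply/malgP => b; rewrite mcoeffZ (mcoeffMlw _ (fsubset_refl _) (msuppZ_le _ _)).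
rewrite mcoeffMl mulr_sumr; apply: eq_bigr => c _; rewrite mulr_sumr.
by apply: eq_bigr => d _; rewrite mcoeffZ mulrnAr mulrCA.
Qed.

Fact rmul_is_linear (M : monomType) (y : {malg k[M]}) : linear (rmul y).
Proof. by move=> a x z; rewrite /rmul mulrDl scalerAl. Qed.

HB.instance Definition _ (M : monomType) (x : {malg k[M]}) :=
  GRing.isLinear.Build k {malg k[M]} {malg k[M]} _ (lmul x) (lmul_is_linear x).
HB.instance Definition _ (M : monomType) (y : {malg k[M]}) :=
  GRing.isLinear.Build k {malg k[M]} {malg k[M]} _ (rmul y) (rmul_is_linear y).

Lemma malg_monoid_morphism (M N : monomType)
    (f : {linear {malg k[M]} -> {malg k[N]}}) :
  f << mone >> = << mone >> ->
  (forall b c, f << mmul b c >> = f << b >> * f << c >>) ->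
  GRing.monoid_morphism f.
Proof.
move=> f1 fM; split; first by rewrite -malgU1 f1 malgU1.
move=> x y; move: x; apply: (linear_malg_ext (f := f \o rmul y)
                               (g := rmul (f y) \o f)) => b /=.
move: y; apply: (linear_malg_ext (f := f \o lmul << b >>)
                   (g := lmul (f << b >>) \o f)) => c /=.
by rewrite /lmul malg_mulUU fM.
Qed.

Lemma tens11 (M N : monomType) : tens (1 : {malg k[M]}) (1 : {malg k[N]}) = 1.
Proof. by rewrite -!malgU1 tensUU. Qed.

Lemma tensM (M N : monomType) (x x' : {malg k[M]}) (y y' : {malg k[N]}) :
  tens x y * tens x' y' = tens (x * x') (y * y').
Proof.
move: x; apply: (linear_malg_ext (f := rmul (tens x' y') \o tensr y)
                   (g := tensr (y * y') \o rmul x')) => b /=.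
move: y; apply: (linear_malg_ext (f := rmul (tens x' y') \o tens << b >>)
                   (g := tens (<< b >> * x') \o rmul y')) => c /=.
move: x'; apply: (linear_malg_ext
  (f := lmul (tens << b >> << c >>) \o tensr y')
  (g := tensr (<< c >> * y') \o lmul << b >>)) => b' /=.
move: y'; apply: (linear_malg_ext
  (f := lmul (tens << b >> << c >>) \o tens << b' >>)
  (g := tens (<< b >> * << b' >>) \o lmul << c >>)) => c' /=.
by rewrite /lmul !tensUU !malg_mulUU tensUU.
Qed.

Lemma tmap_monoid_morphism (M M' N N' : monomType)
    (f : {linear {malg k[M]} -> {malg k[M']}})
    (g : {linear {malg k[N]} -> {malg k[N']}}) :
  GRing.monoid_morphism f -> GRing.monoid_morphism g ->
  GRing.monoid_morphism (tmap f g).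
Proof.
move=> [f1 fM] [g1 gM]; apply: malg_monoid_morphism => [|[b c] [b' c']].
  by rewrite -[LHS]/(tmap f g << (mone, mone) >>) tmapU /= !malgU1 f1 g1 tens11.
rewrite -[LHS]/(tmap f g << (mmul b b', mmul c c') >>).
rewrite -[RHS]/(tmap f g << (b, c) >> * tmap f g << (b', c') >>) !tmapU /=.
by rewrite -!malg_mulUU fM gM tensM.
Qed.

Lemma tassoc_monoid_morphism (M N P : monomType) :
  GRing.monoid_morphism (@tassoc k M N P).
Proof.
apply: malg_monoid_morphism => [|[[b c] d] [[b' c'] d']].
  exact: (tassocU mone mone mone).
rewrite -[LHS]/(tassoc << (mmul b b', mmul c c', mmul d d') >>) tassocU.
rewrite -[RHS]/(tassoc << (b, c, d) >> * tassoc << (b', c', d') >>) !tassocU.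
exact/esym/malg_mulUU.
Qed.

Lemma comp_monoid_morphism (R S T : pzSemiRingType) (f : S -> T) (g : R -> S) :
  GRing.monoid_morphism f -> GRing.monoid_morphism g ->
  GRing.monoid_morphism (f \o g).
Proof.
by move=> [f1 fM] [g1 gM]; split=> [|x y] /=; rewrite ?g1 ?f1 // gM fM.
Qed.

(** * The free algebra and the structure shared by all [dual_hopf m] *)

Section FreeMonoid.
Variable A : choiceType.
Local Notation W := {fmonom A}.

Lemma fmonom_consE (a : A) (s : seq A) :
  << FMonom (a :: s) >> = letter k a * << FMonom s >>.
Proof. by rewrite malg_mulUU; congr << _ >>; apply/eqP; rewrite fmP fmM. Qed.

Lemma fmonom_ind (P : W -> Prop) :
  P mone -> (forall a w, P w -> P (mmul (FMonom [:: a]) w)) -> forall w, P w.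
Proof.
move=> P1 PM [s]; elim: s => [|a s Ps].
  by have -> : FMonom [::] = mone :> W by apply/eqP; rewrite fmP fm1.
have -> : FMonom (a :: s) = mmul (FMonom [:: a]) (FMonom s) :> W.
  by apply/eqP; rewrite fmP fmM.
exact: PM.
Qed.

(** Uniqueness in the universal property of the free algebra: this is what reduces coassociativity
    and comultiplicativity to letters. *)
Lemma free_malg_ext (N : monomType)
    (f g : {linear {malg k[W]} -> {malg k[N]}}) :
  GRing.monoid_morphism f -> GRing.monoid_morphism g ->
  (forall a, f (letter k a) = g (letter k a)) -> f =1 g.
Proof.
move=> [f1 fM] [g1 gM] fg; apply: linear_malg_ext; elim/fmonom_ind => [|a w IH].
  by rewrite malgU1 f1 g1.
by rewrite -malg_mulUU fM gM IH -[<< _ >>]/(letter k a) fg.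
Qed.

(** [o] is the left quotient of [w] by [m]: the hypothesis says that [mmul m n = w] has at most one
    solution [n], the content of [o]. *)
Lemma mcoeff_mulU (M : monomType) (m w : M) (o : option M)
    (x : {malg k[M]}) : (forall n, (mmul m n == w) = (o == Some n)) ->
  (<< m >> * x)@_w = if o is Some n then x@_n else 0.
Proof.
move=> om; rewrite (mcoeffMlw _ (fsubset_refl _) (fsubset_refl _)) msuppU1.
rewrite big_seq_fset1 mcoeffUU; case: o om => [n|] om; last first.
  by rewrite big1 // => n _; rewrite om.
rewrite [in RHS](monalgE x) raddf_sum; apply: eq_bigr => n' _ /=.
by rewrite mul1r mcoeffU om eq_sym.
Qed.

Lemma dual_concU (u v : W) : @dual_conc k A << (u, v) >> = << u >> * << v >>.
Proof. by rewrite malg_mulUU; apply: linextU. Qed.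

Lemma dual_conc_tens (x y : {malg k[W]}) : @dual_conc k A (tens x y) = x * y.
Proof.
move: x; apply: (linear_malg_ext (f := @dual_conc k A \o tensr y)
                                 (g := rmul y)) => u /=.
move: y; apply: (linear_malg_ext (f := @dual_conc k A \o tens << u >>)
                                 (g := lmul << u >>)) => v /=.
by rewrite tensUU dual_concU.
Qed.

Lemma dual_hopf_algebra m : is_algebra (@dual_hopf k A m).
Proof.
split=> [|x|x] /=; last 2 first.
- by rewrite dual_conc_tens malgU1 mul1r.
- by rewrite dual_conc_tens malgU1 mulr1.
apply: (linear_malg_ext (f := @dual_conc k A \o tmap (@dual_conc k A) idfun)
  (g := @dual_conc k A \o tmap idfun (@dual_conc k A) \o @tassoc k W W W)).
move=> [[u v] w] /=; rewrite tassocU.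
rewrite 2!tmapU [LHS]dual_conc_tens [RHS]dual_conc_tens /=.
transitivity (<< u >> * << v >> * << w >> : {malg k[W]}).
  by congr (_ * _); apply: dual_concU.
by rewrite -mulrA; congr (_ * _); apply/esym/dual_concU.
Qed.

(** The swap followed by two concatenations is the product of the tensor square, so the bialgebra
    compatibility axiom amounts to the coproduct being a ring morphism. *)
Lemma tmap_conc_tswap_tens (x y : {malg k[(W * W)%type]}) :
  tmap (@dual_conc k A) (@dual_conc k A) (tswap (tens x y)) = x * y.
Proof.
pose F := tmap (@dual_conc k A) (@dual_conc k A) \o @tswap k W W W W.
move: x; apply: (linear_malg_ext (f := F \o tensr y) (g := rmul y)) => -[u u'] /=.
move: y; apply: (linear_malg_ext (f := F \o tens << (u, u') >>)
                                 (g := lmul << (u, u') >>)) => -[v v'] /=.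
rewrite tensUU tswapU tmapU /lmul -[<< (u, u') >>]tensUU -[<< (v, v') >>]tensUU.
by rewrite tensM; congr (tens _ _); apply: dual_concU.
Qed.

Lemma dual_hopf_comul_mul (m : W -> W -> {malg k[W]}) :
  GRing.monoid_morphism (dual_coprod m) ->
  let H := dual_hopf m in
  (forall t, hcomul H (hmul H t)
     = tmap (hmul H) (hmul H) (tswap (tmap (hcomul H) (hcomul H) t)))
  /\ hcomul H (hone H) = tens (hone H) (hone H).
Proof.
move=> [m1 mM] /=; split; last by rewrite malgU1 m1 tens11.
pose F := tmap (@dual_conc k A) (@dual_conc k A) \o @tswap k W W W W.
apply: (linear_malg_ext (f := dual_coprod m \o @dual_conc k A)
         (g := F \o tmap (dual_coprod m) (dual_coprod m))) => -[u v] /=.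
by rewrite dual_concU mM tmapU tmap_conc_tswap_tens.
Qed.

Lemma dual_counitU (w : W) : @dual_counit k A << w >> = (w == mone)%:R.
Proof. by rewrite [LHS]linextU /pairing msuppU1 big_seq_fset1 mcoeffUU mul1r mcoeffU. Qed.

Lemma dual_counitE (x : {malg k[W]}) : @dual_counit k A x = x@_mone.
Proof.
rewrite [in RHS](monalgE x) [in LHS](monalgE x) !raddf_sum.
apply: eq_bigr => w _ /=; rewrite mcoeffU.
by rewrite malgUZ linearZ_LR /= dual_counitU -[LHS]/(_ * _) mulr_natr.
Qed.

Lemma dual_counitM (x y : {malg k[W]}) :
  @dual_counit k A (x * y) = @dual_counit k A x * @dual_counit k A y.
Proof.
rewrite !dual_counitE; have [mM _] := mcoeff1g_is_multiplicative W k.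
exact: mM.
Qed.

Lemma dual_hopf_counit m :
  let H := @dual_hopf k A m in
  (forall x y, hcounit H (hmul H (tens x y)) = hcounit H x * hcounit H y)
  /\ hcounit H (hone H) = 1.
Proof.
split=> [x y|] /=; last by rewrite dual_counitU eqxx.
by rewrite dual_conc_tens dual_counitM.
Qed.

End FreeMonoid.

End MonoidAlgebra.

(** * The coproduct dual to the quasi-shuffle *)

Section DualCoproduct.
Set Implicit Arguments.
Unset Strict Implicit.
Variables (k : fieldType) (A : choiceType) (deg : A -> nat).
Hypothesis deg_gt0 : forall a : A, (0 < deg a)%N.
Hypothesis A_finite : forall n : nat, finite_set [set a : A | deg a = n].
Local Notation W := {fmonom A}.

Lemma eq_FMonom (s t : seq A) : (FMonom s == FMonom t) = (s == t).
Proof. by rewrite fmP. Qed.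

Lemma mone_nil : mone = FMonom [::] :> W.
Proof. by apply/eqP; rewrite fmP fm1. Qed.

Lemma mmul_FMonom (s t : seq A) : mmul (FMonom s) (FMonom t) = FMonom (s ++ t).
Proof. by apply/eqP; rewrite fmP fmM. Qed.

Lemma mcoeff_letterM (a : A) (x : {malg k[W]}) (s : seq A) :
  (letter k a * x)@_(FMonom s)
  = if s is b :: s' then x@_(FMonom s') *+ (a == b) else 0.
Proof.
rewrite (mcoeff_mulU (o := if s is b :: s' then
                             if a == b then Some (FMonom s') else None
                           else None)).
  by case: s => // b s; case: eqP.
move=> [n]; rewrite mmul_FMonom eq_FMonom; case: s => // b s /=; rewrite eqseq_cons.
case: (a == b) => //=; rewrite eq_sym.
by apply/eqP/eqP => [->|[]].
Qed.

Section QuasiShuffle.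
Variable br : option A -> option A -> option A.
Hypothesis S3 : forall a b : A, br (Some a) (Some b) = None \/
  exists2 c : A, br (Some a) (Some b) = Some c & deg c = (deg a + deg b)%N.
Local Notation qsh := (@quasi_shuffle k A br).
Local Notation delta := (@dual_coprod k A qsh).

Definition bracket_pairs (c : A) : {fset A * A} :=
  fset_set [set p | br (Some p.1) (Some p.2) = Some c].

(** By (S3), [a, b] = c bounds the degrees of a and b by that of c, which leaves finitely many
    pairs. This finiteness matters because [fset_set] of an infinite set is the empty set by
    default. *)
Lemma mem_bracket_pairs c p :
  (p \in bracket_pairs c) = (br (Some p.1) (Some p.2) == Some c).
Proof.
rewrite in_fset_set; first by apply/idP/eqP; rewrite inE.
have Ln : finite_set [set a | (deg a <= deg c)%N].
  apply: (@sub_finite_set _ _ (\bigcup_(i in `I_(deg c).+1) [set a | deg a = i])).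
    by move=> a /= an; exists (deg a).
  by apply: bigcup_finite => // i _; exact: A_finite.
apply: sub_finite_set (finite_setX Ln Ln) => -[a b] /= abc.
have [|[d]] := S3 a b; rewrite abc // => -[<-] ->.
by rewrite leq_addr leq_addl.
Qed.

Definition comul_letter (c : A) : {malg k[(W * W)%type]} :=
  tens (letter k c) 1 + tens 1 (letter k c)
  + \sum_(p <- bracket_pairs c) tens (letter k p.1) (letter k p.2).

Lemma mcoeff_comul u v w : (delta << w >>)@_(u, v) = (qsh u v)@_w.
Proof.
by rewrite (dual_coprodE deg_gt0 A_finite) ?pairingU //; apply: graded_quasi_shuffle.
Qed.

(** The left quotient of [t] by [s], in the form of the option that [mcoeff_mulU] expects. *)
Definition strip (s t : seq A) : option W :=
  if prefix s t then Some (FMonom (drop (size s) t)) else None.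

Lemma stripP (s t : seq A) n : (s ++ n == t) = (strip s t == Some (FMonom n)).
Proof.
rewrite /strip; case: (boolP (prefix s t)) => [/prefixP[u ->]|st].
  rewrite drop_size_cat // eqseq_cat // eqxx /=.
  by apply/eqP/eqP => [->|[]].
by apply/eqP => ts; case/negP: st; rewrite -ts prefix_prefix.
Qed.

Lemma mcoeff_tensUM (s s' t t' : seq A) (x : {malg k[(W * W)%type]}) :
  (tens << FMonom s >> << FMonom s' >> * x)@_(FMonom t, FMonom t')
  = if prefix s t && prefix s' t' then
      x@_(FMonom (drop (size s) t), FMonom (drop (size s') t'))
    else 0.
Proof.
rewrite tensUU (mcoeff_mulU (M := (W * W)%type) (m := (FMonom s, FMonom s'))
  (w := (FMonom t, FMonom t'))
  (o := if prefix s t && prefix s' t' then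
      Some (FMonom (drop (size s) t), FMonom (drop (size s') t')) else None)).
  by case: ifP.
move=> [[n] [n']].
rewrite -[mmul _ _]/(mmul (FMonom s) (FMonom n), mmul (FMonom s') (FMonom n')).
rewrite xpair_eqE !mmul_FMonom !eq_FMonom !stripP /strip.
by case: (prefix s t) (prefix s' t') => [] [] //=; rewrite andbF.
Qed.

(** The three summands remove the first letter of [s], of [t], or of both; they mirror the three
    terms of the quasi-shuffle recursion. *)
Lemma mcoeff_comul_letterM (c : A) (x : {malg k[(W * W)%type]}) (s t : seq A) :
  (comul_letter c * x)@_(FMonom s, FMonom t) =
  (if s is a :: s' then x@_(FMonom s', FMonom t) *+ (a == c) else 0)
  + (if t is b :: t' then x@_(FMonom s, FMonom t') *+ (b == c) else 0)
  + (if s is a :: s' then if t is b :: t' then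
       x@_(FMonom s', FMonom t') *+ (br (Some a) (Some b) == Some c)
     else 0 else 0).
Proof.
rewrite /comul_letter /letter 2!mulrDl 2!mcoeffD -malgU1 mone_nil; congr (_ + _ + _).
- rewrite mcoeff_tensUM; case: s => //= a s.
  by rewrite ?drop0 ?prefix0s ?andbT eq_sym; case: (a == c).
- rewrite mcoeff_tensUM; case: t => [|b t] /=; first by rewrite andbF.
  by rewrite ?drop0 ?prefix0s ?andbT eq_sym; case: (b == c).
rewrite mulr_suml raddf_sum.
rewrite (eq_bigr (fun p : A * A => if s is a :: s' then if t is b :: t' then
   x@_(FMonom s', FMonom t') *+ (p == (a, b)) else 0 else 0)); last first.
  move=> [a' b'] _ /=; rewrite mcoeff_tensUM.
  case: s => [|a s] //=; case: t => [|b t] /=; first by rewrite andbF.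
  by rewrite ?drop0 ?prefix0s ?andbT xpair_eqE; case: (_ && _).
case: s => [|a s]; first by rewrite big1.
case: t => [|b t]; first by rewrite big1.
rewrite -[br _ _]/(br (Some (a, b).1) (Some (a, b).2)) -mem_bracket_pairs.
have [abc|abc] := boolP ((a, b) \in bracket_pairs c).
  rewrite (big_fsetD1 (a, b)) //= eqxx big1_fset ?addr0 // => p.
  by rewrite !inE => /andP[/negPf ->].
rewrite big1_fset // => p pc _; case: eqP => // pab.
by rewrite -pab pc in abc.
Qed.

(** This is the transpose of the quasi-shuffle recursion. When both words are nonempty the
    coefficients agree term by term; the cases with an empty word are the initial values of the
    recursion. *)
Lemma comul_cons (c : A) (w : seq A) :
  delta << FMonom (c :: w) >> = comul_letter c * delta << FMonom w >>.
Proof.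
apply/malgP => -[[s] [t]]; rewrite mcoeff_comul_letterM !mcoeff_comul.
rewrite /quasi_shuffle; case: s => [|a s].
  case: t => [|b t] /=; rewrite mcoeffU eq_FMonom ?addr0 //.
  rewrite add0r eqseq_cons mcoeff_comul mcoeffU eq_FMonom.
  by case: (b == c); rewrite ?mulr0n.
case: t => [|b t] /=.
  rewrite mcoeffU eq_FMonom !addr0 eqseq_cons mcoeff_comul.
  rewrite /quasi_shuffle /=; case: s => [|a' s]; rewrite mcoeffU eq_FMonom;
  by case: (a == c); rewrite ?mulr0n.
rewrite 2!mcoeffD; congr (_ + _ + _).
- by rewrite mcoeff_letterM [in RHS]mcoeff_comul.
- by rewrite mcoeff_letterM [in RHS]mcoeff_comul.
case: (br _ _) => [d|] /=; last by rewrite mul0r mcoeff0.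
by rewrite mcoeff_letterM [in RHS]mcoeff_comul.
Qed.

Lemma comul_nil : delta << FMonom [::] >> = 1.
Proof.
rewrite -tens11 -!malgU1 tensUU mone_nil; apply/malgP => -[[s] [t]].
rewrite mcoeff_comul mcoeffU xpair_eqE !eq_FMonom /quasi_shuffle /=.
case: s t => [|a s] [|b t] /=; rewrite ?[<< _ >>@_ _]mcoeffU ?eq_FMonom //.
rewrite 2!mcoeffD.
rewrite [X in X + _ + _]mcoeff_letterM [X in _ + X + _]mcoeff_letterM !add0r.
case: (br _ _) => [d|] /=; last by rewrite mul0r mcoeff0.
by rewrite mcoeff_letterM.
Qed.

Lemma comul_letterE c : delta (letter k c) = comul_letter c.
Proof. by rewrite [LHS]comul_cons comul_nil mulr1. Qed.

Lemma comul_monoid_morphism : GRing.monoid_morphism delta.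
Proof.
apply: malg_monoid_morphism; first by
  rewrite [LHS](congr1 (fun w : W => delta << w >>) mone_nil) comul_nil malgU1.
move=> [s] [t]; rewrite mmul_FMonom; elim: s => [|a s IHs] /=.
  by rewrite comul_nil [RHS]mul1r.
rewrite (comul_cons a (s ++ t)) (comul_cons a s) IHs.
exact: mulrA.
Qed.

End QuasiShuffle.

(** The shuffle is the quasi-shuffle of the zero bracket, so the preceding results on the coproduct
    apply to it. *)
Lemma shuffleE : @shuffle k A = @quasi_shuffle k A (fun _ _ => None).
Proof.
apply/funext => -[s]; apply/funext => -[t]; rewrite /shuffle /quasi_shuffle /=.
elim: s t => [//|a s IHs]; elim=> [//|b t IHt] /=.
rewrite -[LHS]addr0; apply: (congr2 +%R); last exact/esym/mul0r.
apply: (congr2 +%R).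
  exact: (congr1 (lmul (letter k a)) (IHs (b :: t))).
exact: (congr1 (lmul (letter k b)) IHt).
Qed.

End DualCoproduct.

(** * The Hopf algebra dual to the shuffle algebra *)

Section ShuffleHopf.
Set Implicit Arguments.
Unset Strict Implicit.
Variables (k : fieldType) (A : choiceType) (deg : A -> nat).
Hypothesis deg_gt0 : forall a : A, (0 < deg a)%N.
Hypothesis A_finite : forall n : nat, finite_set [set a : A | deg a = n].
Local Notation W := {fmonom A}.
Local Notation delta := (@dual_coprod k A (@shuffle k A)).

Let S3 (a b : A) : @None A = None \/
  exists2 c : A, None = Some c & deg c = (deg a + deg b)%N.
Proof. by left. Qed.

Lemma shuffle_comul_monoid_morphism : GRing.monoid_morphism delta.
Proof.
by rewrite shuffleE;
  apply: (@comul_monoid_morphism k A deg deg_gt0 A_finite (fun _ _ => None) S3).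
Qed.

Lemma shuffle_comul_letter a :
  delta (letter k a) = tens (letter k a) 1 + tens 1 (letter k a).
Proof.
rewrite shuffleE.
rewrite (@comul_letterE k A deg deg_gt0 A_finite (fun _ _ => None) S3) /comul_letter.
rewrite big1_fset ?addr0 // => p.
by rewrite (@mem_bracket_pairs A deg A_finite (fun _ _ => None) S3).
Qed.

Lemma linext_counitl (t : {malg k[(W * W)%type]}) v :
  (linext (fun p : W * W => @dual_counit k A << p.1 >> *: << p.2 >>) t)@_v
  = t@_(mone, v).
Proof.
rewrite mcoeff_linext [in RHS](monalgE t) raddf_sum; apply: eq_bigr => -[u u'] _.
rewrite /= dual_counitU mcoeffZ !mcoeffU xpair_eqE -[LHS]/(_ * (_ * _)).
by case: (u == mone); rewrite ?mul1r ?mul0r ?mulr0 // mulr_natr.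
Qed.

Lemma linext_counitr (t : {malg k[(W * W)%type]}) v :
  (linext (fun p : W * W => @dual_counit k A << p.2 >> *: << p.1 >>) t)@_v
  = t@_(v, mone).
Proof.
rewrite mcoeff_linext [in RHS](monalgE t) raddf_sum; apply: eq_bigr => -[u u'] _.
rewrite /= dual_counitU mcoeffZ !mcoeffU xpair_eqE -[LHS]/(_ * (_ * _)).
by case: (u' == mone); rewrite ?andbT ?andbF ?mul1r ?mul0r ?mulr0 // mulr_natr.
Qed.

(** Both sides of coassociativity are ring morphisms on the free algebra, so primitive letters
    suffice. The counit laws are dual to the empty word being a unit for the shuffle. *)
Lemma shuffle_coalgebra : is_coalgebra (dual_hopf (@shuffle k A)).
Proof.
have [d1 dM] := shuffle_comul_monoid_morphism.
split=> /=.
- pose F1 := @tassoc k W W W \o tmap delta idfun \o delta.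
  pose F2 := tmap idfun delta \o delta.
  suff: F1 =1 F2 by [].
  apply: free_malg_ext => [||a].
  + apply: comp_monoid_morphism; last by split.
    apply: comp_monoid_morphism; first exact: tassoc_monoid_morphism.
    by apply: tmap_monoid_morphism; split.
  + apply: comp_monoid_morphism; last by split.
    by apply: tmap_monoid_morphism; split.
  have da := shuffle_comul_letter a; set l := letter k a in da *.
  have e1 : tmap delta idfun (delta l)
          = tens (tens l 1) 1 + tens (tens 1 l) 1 + tens (tens 1 1) l.
    rewrite {1}da (linearD (tmap delta idfun)) /=; apply: (congr2 +%R).
      by rewrite [LHS]tmap_tens /= da; apply: (linearD (tensr 1)).
    by rewrite [LHS]tmap_tens /= d1 tens11.
  have e2 : tmap idfun delta (delta l)
          = tens l (tens 1 1) + (tens 1 (tens l 1) + tens 1 (tens 1 l)).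
    rewrite {1}da (linearD (tmap idfun delta)) /=; apply: (congr2 +%R).
      by rewrite [LHS]tmap_tens /= d1 tens11.
    by rewrite [LHS]tmap_tens /= da; apply: (linearD (tens 1)).
  rewrite -[LHS]/(tassoc (tmap delta idfun (delta l))) e1.
  rewrite -[RHS]/(tmap idfun delta (delta l)) e2.
  rewrite (linearD (@tassoc k W W W)) /= (linearD (@tassoc k W W W)) /=.
  by rewrite -[LHS]addrA; apply: (congr2 +%R); last apply: (congr2 +%R);
    apply: tassoc_tens.
- pose G : {linear {malg k[(W * W)%type]} -> {malg k[W]}} :=
    linext (k := k) (fun p : W * W =>
                       (@dual_counit k A << p.1 >> : k) *: << p.2 >>).
  apply: (linear_malg_ext (f := G \o delta) (g := idfun)) => w /=.
  (* The contraction keeps the coefficient at (1, v), which by duality is the coefficient of [w] in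
     1 sh v = v. *)
  apply/malgP => v; rewrite [LHS]linext_counitl shuffleE.
  rewrite (@mcoeff_comul k A deg deg_gt0 A_finite (fun _ _ => None) S3) mone_nil.
  by rewrite /quasi_shuffle /= fmK !mcoeffU eq_sym.
- pose G : {linear {malg k[(W * W)%type]} -> {malg k[W]}} :=
    linext (k := k) (fun p : W * W =>
                       (@dual_counit k A << p.2 >> : k) *: << p.1 >>).
  apply: (linear_malg_ext (f := G \o delta) (g := idfun)) => w /=.
  apply/malgP => v; rewrite [LHS]linext_counitr shuffleE.
  rewrite (@mcoeff_comul k A deg deg_gt0 A_finite (fun _ _ => None) S3) mone_nil.
  by rewrite /quasi_shuffle; case: v => -[|b v] /=; rewrite !mcoeffU eq_sym.
Qed.

Definition shuffle_antipode : {malg k[W]} -> {malg k[W]} :=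
  linext (fun w : W => (-1) ^+ size w *: << FMonom (rev w) >>).
HB.instance Definition _ := GRing.Linear.on shuffle_antipode.

Lemma shuffle_antipodeE s :
  shuffle_antipode << FMonom s >> = (-1) ^+ size s *: << FMonom (rev s) >>.
Proof. exact: linextU. Qed.

Lemma shuffle_antipode_cons a s :
  shuffle_antipode << FMonom (a :: s) >>
  = - (shuffle_antipode << FMonom s >> * letter k a).
Proof.
rewrite !shuffle_antipodeE -scalerAl malg_mulUU mmul_FMonom rev_cons -cats1 exprS.
by rewrite mulN1r scaleNr.
Qed.

Lemma shuffle_antipode_rcons a s :
  shuffle_antipode << FMonom (rcons s a) >>
  = - (letter k a * shuffle_antipode << FMonom s >>).
Proof.
rewrite !shuffle_antipodeE -[letter k a * _]/(lmul _ _) linearZ_LR /= /lmul.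
by rewrite /letter malg_mulUU mmul_FMonom rev_rcons size_rcons exprS mulN1r scaleNr.
Qed.

(* S(au) v + S(u) av = 0, because S(au) = - S(u) a. *)
Lemma shuffle_antipode_letterMl a (t : {malg k[(W * W)%type]}) :
  dual_conc (tmap shuffle_antipode idfun
    ((tens (letter k a) 1 + tens 1 (letter k a)) * t)) = 0.
Proof.
move: t; apply: (linear_malg_ext
  (f := @dual_conc k A \o tmap shuffle_antipode idfun
          \o lmul (tens (letter k a) 1 + tens 1 (letter k a)))
  (g := \0)) => -[[s] [t]] /=.
have -> : lmul (tens (letter k a) 1 + tens 1 (letter k a))
               << (FMonom s, FMonom t) >>
        = << (FMonom (a :: s), FMonom t) >> + << (FMonom s, FMonom (a :: t)) >>.
  rewrite /lmul [LHS]mulrDl; apply: (congr2 +%R).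
    rewrite -(tensUU (FMonom s)) [LHS]tensM -(tensUU (FMonom (a :: s))).
    by rewrite fmonom_consE; congr (tens _ _); apply: mul1r.
  rewrite -(tensUU (FMonom s)) [LHS]tensM -(tensUU (FMonom s)).
  by rewrite fmonom_consE; congr (tens _ _); apply: mul1r.
rewrite (linearD (tmap shuffle_antipode idfun)) (linearD (@dual_conc k A)) /=.
rewrite [X in dual_conc X + _]tmapU [X in _ + dual_conc X]tmapU /=.
rewrite [X in X + _]dual_conc_tens [X in _ + X]dual_conc_tens.
by rewrite shuffle_antipode_cons [X in _ + _ * X]fmonom_consE mulrA mulNr addNr.
Qed.

(** The mirror image: u a S(v) + u S(va) = 0 because S(va) = - a S(v). *)
Lemma shuffle_antipode_letterMr a (t : {malg k[(W * W)%type]}) :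
  dual_conc (tmap idfun shuffle_antipode
    (t * (tens (letter k a) 1 + tens 1 (letter k a)))) = 0.
Proof.
move: t; apply: (linear_malg_ext
  (f := @dual_conc k A \o tmap idfun shuffle_antipode
          \o rmul (tens (letter k a) 1 + tens 1 (letter k a)))
  (g := \0)) => -[[s] [t]] /=.
have rconsE u : << FMonom u >> * letter k a = << FMonom (rcons u a) >>.
  by rewrite malg_mulUU mmul_FMonom cats1.
have -> : rmul (tens (letter k a) 1 + tens 1 (letter k a))
               << (FMonom s, FMonom t) >>
        = << (FMonom (rcons s a), FMonom t) >>
          + << (FMonom s, FMonom (rcons t a)) >>.
  rewrite /rmul [LHS]mulrDr; apply: (congr2 +%R).
    rewrite -(tensUU (FMonom s)) [LHS]tensM -(tensUU (FMonom (rcons s a))).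
    by rewrite rconsE; congr (tens _ _); apply: mulr1.
  rewrite -(tensUU (FMonom s)) [LHS]tensM -(tensUU (FMonom s)).
  by rewrite rconsE; congr (tens _ _); apply: mulr1.
rewrite (linearD (tmap idfun shuffle_antipode)) (linearD (@dual_conc k A)) /=.
rewrite [X in dual_conc X + _]tmapU [X in _ + dual_conc X]tmapU /=.
rewrite [X in X + _]dual_conc_tens [X in _ + X]dual_conc_tens.
by rewrite shuffle_antipode_rcons -rconsE mulrN mulrA addrN.
Qed.

(** A nonempty word is split at its first letter for S on the left and at its last letter for S on
    the right; the coproduct being multiplicative, the two cancellation lemmas give 0, which is the
    counit value. *)
Lemma shuffle_is_antipode :
  is_antipode (dual_hopf (@shuffle k A)) shuffle_antipode.
Proof.
have [d1 dM] := shuffle_comul_monoid_morphism.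
have S1 : shuffle_antipode 1 = 1.
  by rewrite -malgU1 mone_nil shuffle_antipodeE scale1r.
pose K := @dual_hopf k A (@shuffle k A).
suff H : conv_unit K K =1 convolution K K shuffle_antipode idfun
      /\ conv_unit K K =1 convolution K K idfun shuffle_antipode.
  by move=> x; rewrite -[_ *: _]/(conv_unit K K x) {1}H.1 H.2.
split.
- apply: (linear_malg_ext (f := conv_unit K K) (g := @dual_conc k A
    \o tmap shuffle_antipode idfun \o delta)) => -[[|a s]] /=.
    rewrite /conv_unit /= dual_counitU -!mone_nil eqxx scale1r malgU1 d1 -tens11.
    by rewrite tmap_tens dual_conc_tens /= S1 mulr1.
  rewrite fmonom_consE dM shuffle_comul_letter shuffle_antipode_letterMl.
  by rewrite /conv_unit /= dual_counitM dual_counitU mone_nil mul0r scale0r.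
- apply: (linear_malg_ext (f := conv_unit K K) (g := @dual_conc k A
    \o tmap idfun shuffle_antipode \o delta)) => -[s] /=.
  case/lastP: s => [|s a].
    rewrite /conv_unit /= dual_counitU -!mone_nil eqxx scale1r malgU1 d1 -tens11.
    by rewrite tmap_tens dual_conc_tens /= S1 mulr1.
  have -> : << FMonom (rcons s a) >> = << FMonom s >> * letter k a.
    by rewrite malg_mulUU mmul_FMonom cats1.
  rewrite dM shuffle_comul_letter shuffle_antipode_letterMr.
  by rewrite /conv_unit /= dual_counitM [X in _ * X]dual_counitU mone_nil mulr0 scale0r.
Qed.

Lemma shuffle_hopf_algebra : is_hopf_algebra (dual_hopf (@shuffle k A)).
Proof.
split; last by exists shuffle_antipode; apply: shuffle_is_antipode.
split; [exact: dual_hopf_algebra | exact: shuffle_coalgebra | |].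
  exact/dual_hopf_comul_mul/shuffle_comul_monoid_morphism.
exact: dual_hopf_counit.
Qed.

End ShuffleHopf.

(** * The transpose of the exponential *)

Section Compositions.
Set Implicit Arguments.
Unset Strict Implicit.

(* m is the fuel of the recursion: the enumeration is complete if n <= m. *)
Fixpoint composition_seq (m n : nat) : seq (seq nat) :=
  if n is 0 then [:: [::]] else
  if m is m'.+1 then
    [seq i :: J | i <- iota 1 n, J <- composition_seq m' (n - i)%N]
  else [::].

Lemma composition_seq_uniq m n : uniq (composition_seq m n).
Proof.
elim: m n => [|m IHm] [|n] //.
apply: (@allpairs_uniq_dep _ _ _ (fun i J => i :: J)).
- exact: iota_uniq.
- by move=> i _; exact: IHm.
by move=> [i J] [i' J'] _ _ /= [-> ->].
Qed.

Lemma composition_seqS m n : composition_seq m.+1 n.+1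
  = [seq i :: J | i <- iota 1 n.+1, J <- composition_seq m (n.+1 - i)%N].
Proof. by []. Qed.

Lemma composition_seqSP m n (K : seq nat) :
  reflect (exists i J, [/\ i \in iota 1 n.+1, J \in composition_seq m (n.+1 - i)
                          & K = i :: J])
          (K \in composition_seq m.+1 n.+1).
Proof. exact: (@allpairsPdep _ _ _ (fun i J => i :: J)). Qed.

Lemma mem_composition_seq m n I : (n <= m)%N ->
  (I \in composition_seq m n) = all (fun i => 0 < i)%N I && (sumn I == n).
Proof.
elim: m n I => [|m IHm] [|n] // [|i I] nm; rewrite /= ?inE //.
- by rewrite addn_eq0; case: i => //= i; rewrite andbF.
- by rewrite addn_eq0; case: i => //= i; rewrite andbF.
- by apply/composition_seqSP => -[? [? []]].
apply/idP/idP => [/composition_seqSP[j [J [jn JP [-> ->]]]]|/andP[/andP[i0 I0]] /eqP iI].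
  move: jn; rewrite mem_iota add1n ltnS => /andP[j0 jn]; rewrite j0 /=.
  (* The first part [j] is at least 1, so the remainder fits in one unit of fuel less. *)
  have jm : (n.+1 - j <= m)%N.
    by rewrite leq_subLR (leq_trans nm) // -add1n leq_add2r.
  by move: JP; rewrite IHm // => /andP[-> /eqP ->]; rewrite subnKC ?eqxx // -ltnS.
apply/composition_seqSP; exists i, I; split=> //;
  rewrite ?mem_iota ?i0 -iI ?add1n ?ltnS ?leq_addr //.
rewrite addKn IHm ?I0 ?eqxx // -ltnS (leq_trans _ nm) // -iI.
by rewrite -[X in (X < _)%N]add0n ltn_add2r.
Qed.

Lemma composition_seqE m n : (n <= m)%N ->
  compositions n = [set` composition_seq m n].
Proof.
move=> nm; apply/seteqP; split=> I /=.
  by case=> I0 In; rewrite mem_composition_seq // I0 In /=.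
by rewrite mem_composition_seq // => /andP[I0 /eqP].
Qed.

End Compositions.

(** * The multiplicative map [exp_star] and its duality with [exp_word] *)

Section Exponential.
Set Implicit Arguments.
Unset Strict Implicit.
Variables (k : fieldType) (A : choiceType) (deg : A -> nat).
Hypothesis deg_gt0 : forall a : A, (0 < deg a)%N.
Hypothesis A_finite : forall n : nat, finite_set [set a : A | deg a = n].
Local Notation W := {fmonom A}.

Variable br : option A -> option A -> option A.
Hypothesis S0 : forall x, br x None = None.
Hypothesis S1 : forall x y, br x y = br y x.
Hypothesis S2 : forall x y z, br (br x y) z = br x (br y z).
Hypothesis S3 : forall a b : A, br (Some a) (Some b) = None \/
  exists2 c : A, br (Some a) (Some b) = Some c & deg c = (deg a + deg b)%N.

(* br has no unit (None is absorbing): oAC adjoins one, so that brackets of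
   nonempty words become iterated products of a commutative monoid. *)
Let brA : associative br. Proof. by move=> x y z; rewrite S2. Qed.
Let brU := oAC brA S1.

Let brackets_big a s :
  Some (brackets br (a :: s)) = \big[brU/None]_(b <- a :: s) Some (Some b).
Proof.
elim: s a => [|b s IHs] a; first by rewrite big_seq1.
by rewrite big_cons -IHs /brU oACE.
Qed.

Lemma perm_brackets s t : perm_eq s t -> brackets br s = brackets br t.
Proof.
case: s t => [|a s] [|b t] st //; try by have := perm_size st.
by apply: Some_inj; rewrite !brackets_big (perm_big _ st).
Qed.

Lemma brackets_cat a s b t :
  brackets br ((a :: s) ++ (b :: t))
  = br (brackets br (a :: s)) (brackets br (b :: t)).
Proof.
apply: Some_inj; rewrite cat_cons brackets_big -cat_cons big_cat /=.
by rewrite -!brackets_big /brU oACE.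
Qed.

Lemma wdeg_brackets s c : brackets br s = Some c -> wdeg deg s = deg c.
Proof.
elim: s c => [//|a s IHs] c; case: s IHs => [|b s] IHs /=.
  by case=> ->; rewrite /wdeg /= addn0.
rewrite -[X in br _ X]/(brackets br (b :: s)).
case: (brackets br (b :: s)) IHs => [d|] IHs; last by rewrite S0.
case: (S3 a d) => [->//|[e -> ed] [<-]].
by rewrite ed -(IHs d).
Qed.

(** The degree bound only makes the support visibly finite: by [wdeg_brackets] every word with
    bracket [c] satisfies it. The empty word has bracket [None], hence coefficient 0. *)
Definition exp_letter (c : A) : {malg k[W]} :=
  [malg w in fset_set [set w : W | (wdeg deg w <= deg c)%N] =>
     if brackets br w == Some c then (size w)`!%:R^-1 else 0].

Lemma mcoeff_exp_letter c (w : W) :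
  (exp_letter c)@_w = if brackets br w == Some c then (size w)`!%:R^-1 else 0.
Proof.
rewrite mcoeffE; case: ifPn => //; case: eqP => // wc.
rewrite in_fset_set; last exact: finite_wdeg_le.
by rewrite notin_setE /= (wdeg_brackets wc) leqnn.
Qed.

(** Defined as the multiplicative extension of [exp_letter], which makes it a ring morphism from the
    start; that it is the transpose of exp is proved through coefficients. *)
Definition exp_star : {malg k[W]} -> {malg k[W]} :=
  linext (fun w : W => \prod_(a <- w) exp_letter a).
HB.instance Definition _ := GRing.Linear.on exp_star.

Lemma exp_starU (w : W) : exp_star << w >> = \prod_(a <- w) exp_letter a.
Proof. exact: linextU. Qed.

Lemma exp_star_monoid_morphism : GRing.monoid_morphism exp_star.
Proof.
apply: malg_monoid_morphism => [|[s] [t]].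
  by rewrite [LHS]exp_starU fm1 big_nil malgU1.
by rewrite mmul_FMonom [LHS]exp_starU [in RHS]/= 2!exp_starU big_cat.
Qed.

Lemma exp_star_letter c : exp_star (letter k c) = exp_letter c.
Proof. by rewrite exp_starU /= big_seq1. Qed.

Lemma exp_star_cons c s :
  exp_star << FMonom (c :: s) >> = exp_letter c * exp_star << FMonom s >>.
Proof. by rewrite !exp_starU /= big_cons. Qed.

(** Concatenation is dual to deconcatenation: each way of cutting [s] in two contributes one
    term. *)
Lemma mcoeff_mul_split (x y : {malg k[W]}) (s : seq A) :
  (x * y)@_(FMonom s)
  = \sum_(i < (size s).+1) x@_(FMonom (take i s)) * y@_(FMonom (drop i s)).
Proof.
rewrite [in LHS](monalgE x) mulr_suml raddf_sum.
under [RHS]eq_bigr do rewrite [in X in X * _](monalgE x) raddf_sum mulr_suml.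
rewrite [RHS]exchange_big; apply: eq_bigr => -[v] _ /=.
rewrite malgUZ -scalerAl mcoeffZ (mcoeff_mulU (o := strip v s)); last first.
  by move=> [n]; rewrite mmul_FMonom eq_FMonom stripP.
have E (i : 'I_(size s).+1) :
    (x@_(FMonom v) *: << FMonom v >>)@_(FMonom (take i s))
    * y@_(FMonom (drop i s))
  = if v == take i s then x@_(FMonom v) * y@_(FMonom (drop i s)) else 0.
  rewrite mcoeffZ mcoeffU eq_FMonom; case: eqP; rewrite ?mulr1 //.
  by rewrite mulr0 mul0r.
under [RHS]eq_bigr do rewrite E.
rewrite /strip; case: (boolP (prefix v s)) => [vs|nvs]; last first.
  rewrite mulr0 big1 // => i _; case: eqP => // vi.
  by case/negP: nvs; rewrite vi prefix_take.
have vlt : (size v < (size s).+1)%N by rewrite ltnS size_prefix.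
rewrite (bigD1 (Ordinal vlt)) //= big1 => [|i /eqP iv].
  by move: vs; rewrite prefixE => /eqP ->; rewrite eqxx addr0.
case: eqP => // vi; case: iv; apply/val_inj => /=.
by rewrite vi size_takel // -ltnS.
Qed.

Lemma exp_word_nil : exp_word k br (FMonom [::]) = 1.
Proof.
rewrite /exp_word (composition_seqE (leqnn 0)) -fsbig_seq //= big_seq1 big_nil.
by rewrite /comp_act /= big_nil invr1 scale1r.
Qed.

Lemma exp_wordE m s : (size s <= m)%N -> exp_word k br (FMonom s)
  = \sum_(I <- composition_seq m (size s))
      (\prod_(i <- I) i`!%:R)^-1 *: comp_act k br I (FMonom s).
Proof.
by move=> sm; rewrite /exp_word (composition_seqE sm) -fsbig_seq //
  composition_seq_uniq.
Qed.

(** Compositions are grouped by their first part i, which ranges from 1 to the length of the word;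
    the remaining parts form a composition of what is left. *)
Lemma exp_word_cons a s :
  exp_word k br (FMonom (a :: s))
  = \sum_(i <- iota 1 (size s).+1) i`!%:R^-1 *:
      (oletter k (brackets br (take i (a :: s)))
         * exp_word k br (FMonom (drop i (a :: s)))).
Proof.
rewrite (exp_wordE (m := (size s).+1)) // composition_seqS.
rewrite (big_allpairs_dep (h := fun i J => i :: J)).
rewrite [LHS]big_seq [RHS]big_seq; apply: eq_bigr => i.
rewrite mem_iota => /andP[i0 _].
rewrite (exp_wordE (m := size s)); last first.
  by rewrite size_drop /= leq_subLR -add1n leq_add2r.
rewrite size_drop mulr_sumr scaler_sumr; apply: eq_bigr => I _.
rewrite big_cons /comp_act /= big_cons invfM -scalerA; congr (_ *: _).
by rewrite -[RHS]/(lmul _ _) linearZ.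
Qed.

(** By induction on [w]: its first letter must be the bracket of a prefix of [u], so cutting [u] in
    [mcoeff_mul_split] matches choosing the first part in [exp_word_cons]. *)
Lemma mcoeff_exp_star (u w : W) :
  (exp_star << w >>)@_u = (exp_word k br u)@_w.
Proof.
have [f1 _] := exp_star_monoid_morphism.
have oletter0 (o : option A) (x : {malg k[W]}) :
    (oletter k o * x)@_(FMonom [::]) = 0.
  by case: o => [d|] /=; rewrite ?mcoeff_letterM // mul0r mcoeff0.
case: u w => [u] [w]; elim: w u => [|c w IHw] u.
  rewrite [exp_star _](_ : _ = 1); last first.
    by rewrite exp_starU big_nil.
  case: u => [|a u]; first by rewrite exp_word_nil.
  rewrite exp_word_cons raddf_sum big1 => [|i _] /=.
    by rewrite -malgU1 mone_nil mcoeffU eq_FMonom.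
  by rewrite mcoeffZ oletter0 mulr0.
(* The cut at 0 is split off: its prefix is empty, with bracket [None], so the term vanishes and the
   lengths from 1 on remain. *)
rewrite exp_star_cons mcoeff_mul_split big_ord_recl take0 mcoeff_exp_letter.
rewrite [brackets _ _]/= [X in X + _]mul0r add0r.
case: u => [|a u].
  by rewrite big_ord0 exp_word_nil -malgU1 mone_nil mcoeffU eq_FMonom.
rewrite exp_word_cons raddf_sum -[1%N]/(1 + 0)%N iotaDl big_map.
have -> : iota 0 (size u).+1 = index_iota 0 (size u).+1.
  by rewrite /index_iota subn0.
rewrite big_mkord.
apply: eq_bigr => i _; rewrite mcoeff_exp_letter IHw [RHS]mcoeffZ.
rewrite size_takel; last by rewrite -ltnS; apply: (ltn_ord (lift ord0 i)).
rewrite lift0 add1n; case: (brackets _ _) => [d|] /=.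
  rewrite mcoeff_letterM -[Some d == _]/(d == c).
  by case: (d == c); rewrite ?mulr0n ?mulr0 ?mul0r.
by rewrite mul0r [in RHS]mul0r mcoeff0 mulr0.
Qed.

End Exponential.

(** * Comultiplicativity and bijectivity *)

Section Unipotent.
Set Implicit Arguments.
Unset Strict Implicit.

Lemma bijective_locally_unipotent (V : zmodType) (f : {additive V -> V}) :
  (forall x, exists n, iter n (fun y => f y - y) x = 0) -> bijective f.
Proof.
move=> fN; have f_inj : injective f.
  apply: raddf_inj => x fx0; have [n] := fN x.
  elim: n x fx0 => [//|n IHn] x fx0; rewrite iterSr fx0 sub0r => /IHn.
  by rewrite raddfN fx0 oppr0 => /(_ erefl)/eqP; rewrite oppr_eq0 => /eqP.
have f_surj x : exists y, f y = x.
  have [n] := fN x; elim: n x => [x /= ->|n IHn x].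
    by exists 0; rewrite raddf0.
  (* Here f y = f x - x, hence f (x - y) = x. *)
  rewrite iterSr => /IHn[y fy]; exists (x - y).
  by rewrite raddfB fy opprB addrCA subrr addr0.
have [g fg] := boolp.choice f_surj.
by exists g => x //; apply: f_inj; rewrite fg.
Qed.

End Unipotent.

Section ExponentialIsomorphism.
Set Implicit Arguments.
Unset Strict Implicit.
Variables (k : fieldType) (A : choiceType) (deg : A -> nat).
Hypothesis fact_neq0 : forall n, n`!%:R != 0 :> k.
Hypothesis deg_gt0 : forall a : A, (0 < deg a)%N.
Hypothesis A_finite : forall n : nat, finite_set [set a : A | deg a = n].
Local Notation W := {fmonom A}.

Variable br : option A -> option A -> option A.
Hypothesis S0 : forall x, br x None = None.
Hypothesis S1 : forall x y, br x y = br y x.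
Hypothesis S2 : forall x y z, br (br x y) z = br x (br y z).
Hypothesis S3 : forall a b : A, br (Some a) (Some b) = None \/
  exists2 c : A, br (Some a) (Some b) = Some c & deg c = (deg a + deg b)%N.

Lemma pairingE (x y : {malg k[W]}) :
  pairing x y = linext (fun w => y@_w : k^o) x.
Proof. by []. Qed.

Lemma pairingC (x y : {malg k[W]}) : pairing x y = pairing y x.
Proof.
rewrite !pairingE (linextEw _ (fsubsetUl (msupp x) (msupp y))).
rewrite (linextEw _ (fsubsetUr (msupp x) (msupp y))).
by apply: eq_bigr => w _; apply: mulrC.
Qed.

(** The binomial coefficient counts the words of s sh t with multiplicity, by Pascal's rule along
    the shuffle recursion. [h] varies in the induction, since removing a first letter a replaces it
    by w |-> h(aw). *)
Lemma linext_shuffle (h : W -> k^o) (s t : seq A) (e : k) :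
  (forall w : W, perm_eq w (s ++ t) -> h w = e) ->
  linext h (sh_seq k s t) = 'C(size s + size t, size s)%:R * e.
Proof.
have linext_letterM (g : W -> k^o) a (x : {malg k[W]}) :
    linext g (letter k a * x) = linext (fun w => g (mmul (FMonom [:: a]) w)) x.
  move: x; apply: (linear_malg_ext (f := linext g \o lmul (letter k a))
    (g := linext (fun w => g (mmul (FMonom [:: a]) w)))) => w /=.
  by rewrite /lmul malg_mulUU !linextU.
elim: s t h => [|a s IHs] t h; first by move=> he; rewrite bin0 mul1r linextU he.
elim: t h => [|b t IHt] h he.
  by rewrite addn0 binn mul1r [LHS]linextU he // cats0.
rewrite [sh_seq _ _ _]/= (linearD (linext h)) /=.
rewrite [X in X + _]linext_letterM [X in _ + X]linext_letterM.
rewrite IHs => [|w wst]; last by apply: he; rewrite fmM /= perm_cons.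
rewrite -[X in linext _ X]/(sh_seq k (a :: s) t) IHt => [|w wst]; last first.
  apply: he; rewrite fmM.
  apply: (@perm_trans _ (b :: (a :: s) ++ t)); first by rewrite perm_cons.
  by rewrite -cat1s -[b :: t]cat1s perm_catCA.
rewrite -mulrDl -natrD; congr (_%:R * _).
by rewrite [size (a :: s)]/= [size (b :: t)]/= !addSn !addnS binS addnC.
Qed.

Lemma mcoeff_shuffle_comul (x : {malg k[W]}) (u v : W) :
  (dual_coprod (@shuffle k A) x)@_(u, v) = pairing (shuffle k u v) x.
Proof.
have -> : dual_coprod (@shuffle k A) x
        = linext (fun w => dual_coprod (@shuffle k A) << w >>) x.
  by move: x; apply: linear_malg_ext => w /=; rewrite linextU.
rewrite pairingC pairingE mcoeff_linext; apply: (@eq_linext k W k^o) => w.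
rewrite (dual_coprodE deg_gt0 A_finite) ?pairingU //; exact: graded_shuffle.
Qed.

(** All words of s sh t have the bracket and the length of st, and the binomial coefficient turns 1
    / (|s| + |t|)! into 1 / (|s|! |t|!). Cancelling it uses that factorials are nonzero in [k]. *)
Lemma mcoeff_shuffle_comul_exp c (s t : seq A) :
  (dual_coprod (@shuffle k A) (exp_letter k deg br c))@_(FMonom s, FMonom t)
  = if brackets br (s ++ t) == Some c
    then (size s)`!%:R^-1 * (size t)`!%:R^-1 else 0.
Proof.
rewrite mcoeff_shuffle_comul pairingE (linext_shuffle (s := s) (t := t)
  (e := if brackets br (s ++ t) == Some c then (size (s ++ t))`!%:R^-1 else 0)).
  case: ifP; rewrite ?mulr0 // => _; rewrite size_cat.
  have := fact_neq0 (size s + size t).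
  rewrite -(bin_fact (leq_addr (size t) (size s))) addKn 2!natrM.
  by rewrite mulf_eq0 negb_or => /andP[C0 _]; rewrite !invfM mulVKf.
move=> w wst; rewrite (mcoeff_exp_letter k deg_gt0 A_finite S0 S3).
by rewrite (perm_brackets S1 S2 wst) (perm_size wst).
Qed.

Lemma exp_star_comul_letter c :
  dual_coprod (@shuffle k A) (exp_letter k deg br c)
  = tmap (exp_star deg br) (exp_star deg br)
      (dual_coprod (@quasi_shuffle k A br) (letter k c)).
Proof.
have f1 : @exp_star k A deg br 1 = 1.
  exact: (exp_star_monoid_morphism k deg br).1.
rewrite [in RHS](comul_letterE k deg_gt0 A_finite S3) /comul_letter.
pose f := @exp_star k A deg br; pose E := exp_letter k deg br.
have -> : tmap f f (tens (letter k c) 1 + tens 1 (letter k c)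
    + \sum_(p <- bracket_pairs br c) tens (letter k p.1) (letter k p.2))
  = tens (E c) 1 + tens 1 (E c)
    + \sum_(p <- bracket_pairs br c) tens (E p.1) (E p.2).
  have tD x y : tmap f f (x + y) = tmap f f x + tmap f f y := linearD _ x y.
  rewrite [LHS]tD; apply: (congr2 +%R); last first.
    rewrite [LHS](linear_sum (tmap f f)); apply: eq_bigr => p _.
    by rewrite [LHS]tmap_tens /= 2!exp_star_letter.
  rewrite [LHS]tD; apply: (congr2 +%R).
  - by rewrite [LHS]tmap_tens /= exp_star_letter f1.
  - by rewrite [LHS]tmap_tens /= exp_star_letter f1.
apply/malgP => -[[s] [t]]; rewrite mcoeff_shuffle_comul_exp 2!mcoeffD.
have one u : (1 : {malg k[W]})@_(FMonom u) = (u == [::])%:R.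
  by rewrite -malgU1 mone_nil mcoeffU eq_FMonom eq_sym.
have letterE := mcoeff_exp_letter k deg_gt0 A_finite S0 S3.
rewrite [X in _ = X + _ + _]mcoeff_tens [X in _ = _ + X + _]mcoeff_tens.
rewrite [X in _ = _ + X](raddf_sum (mcoeff _)).
rewrite [X in _ = X * _ + _ + _]letterE [X in _ = _ + _ * X + _]letterE.
rewrite [X in _ = _ * X + _ + _]one [X in _ = _ + X * _ + _]one.
rewrite (eq_bigr (fun p : A * A =>
    (if brackets br s == Some p.1 then (size s)`!%:R^-1 else 0) *
    (if brackets br t == Some p.2 then (size t)`!%:R^-1 else 0))); last first.
  by move=> p _; rewrite [LHS]mcoeff_tens [X in X * _]letterE [X in _ * X]letterE.
(* An exponential of a letter has no constant term, so for empty [s] only 1 (x) E(c) contributes;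
   for empty [t] only E(c) (x) 1 does. *)
case: s => [|a s].
  rewrite big1 => [|p _] /=; last by rewrite mul0r.
  by rewrite mul0r add0r addr0 mul1r fact0 invr1 mul1r.
case: t => [|b t].
  rewrite big1 => [|p _] /=; last by rewrite mulr0.
  by rewrite cats0 mulr0 !addr0 mulr1 fact0 invr1 mulr1.
(* With both words nonempty only the bracket sum is left. The pair (d, e) of the brackets of the two
   words is its only possible contribution, present exactly when [d, e] = c. *)
rewrite mulr0 mul0r !add0r (brackets_cat S1 S2).
case: (brackets br (a :: s)) => [d|]; last first.
  by rewrite S1 S0 big1 // => p _; rewrite mul0r.
case: (brackets br (b :: t)) => [e|]; last first.
  by rewrite S0 big1 // => p _; rewrite mulr0.
set X := (size (a :: s))`!%:R^-1; set Y := (size (b :: t))`!%:R^-1.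
rewrite [RHS](eq_bigr (fun p => if p == (d, e) then X * Y else 0)); last first.
  move=> [p q] _; rewrite xpair_eqE -[Some d == _]/(d == p).
  rewrite -[Some e == _]/(e == q) [d == p]eq_sym [e == q]eq_sym.
  by case: (p == d); case: (q == e); rewrite ?mul0r ?mulr0.
rewrite -[br _ _]/(br (Some (d, e).1) (Some (d, e).2)).
rewrite -(mem_bracket_pairs A_finite S3).
have [dec|dec] := boolP ((d, e) \in bracket_pairs br c).
  rewrite (big_fsetD1 (d, e)) //= eqxx big1_fset ?addr0 // => p.
  by rewrite !inE => /andP[/negPf ->].
rewrite big1_fset // => p pc _; case: eqP => // pab.
by rewrite -pab pc in dec.
Qed.

Lemma msupp_exp_letter c (v : W) : v \in msupp (exp_letter k deg br c) ->
  wdeg deg v = deg c /\ (0 < size v)%N.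
Proof.
rewrite -mcoeff_neq0 (mcoeff_exp_letter k deg_gt0 A_finite S0 S3).
case: ifP => [/eqP vc _|_ /eqP//].
split; first exact: (wdeg_brackets S0 S3 vc).
by case: v vc => -[].
Qed.

(** The word c has coefficient 1/1! = 1, which cancels, and no other one-letter word has bracket
    [c]. *)
Lemma msupp_exp_letter_sub c (v : W) :
  v \in msupp (exp_letter k deg br c - letter k c) ->
  wdeg deg v = deg c /\ (1 < size v)%N.
Proof.
rewrite -mcoeff_neq0 mcoeffB (mcoeff_exp_letter k deg_gt0 A_finite S0 S3).
case: v => v; rewrite /letter mcoeffU eq_FMonom.
have [<-|cv] := eqVneq [:: c] v; first by
  rewrite /= eqxx -[_`!]/1%N invr1 subrr => /eqP.
rewrite subr0; case: ifP => [/eqP vc _|_ /eqP//].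
split; first exact: (wdeg_brackets S0 S3 vc).
by case: v vc cv => [|a [|b v]] //= [->]; rewrite eqxx.
Qed.

Lemma msupp_exp_star_sub (w v : W) :
  v \in msupp (@exp_star k A deg br << w >> - << w >>) ->
  wdeg deg v = wdeg deg w /\ (size w < size v)%N.
Proof.
case: w => w; elim: w v => [|c w IHw] v.
  rewrite exp_starU /= big_nil -malgU1 mone_nil subrr msupp0 //.
(* Telescoping: E(c) f(w) - cw = E(c) (f(w) - w) + (E(c) - c) w, and in each summand one factor
   gains length while the other loses none. *)
have -> : @exp_star k A deg br << FMonom (c :: w) >> - << FMonom (c :: w) >>
    = exp_letter k deg br c * (exp_star deg br << FMonom w >> - << FMonom w >>)
      + (exp_letter k deg br c - letter k c) * << FMonom w >>.
  by rewrite exp_star_cons fmonom_consE mulrBr mulrBl addrA subrK.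
move/(fsubsetP (msuppD_le _ _)); rewrite in_fsetU => /orP[] /msuppM_le.
  move=> [v1 [v2 [/msupp_exp_letter[d1 s1] /IHw[d2 s2] ->]]].
  rewrite fmM /wdeg map_cat sumn_cat size_cat -!/(wdeg _ _) d1 d2; split=> //.
  by rewrite -(addn1 (size _)) addnC leq_add.
move=> [v1 [v2 [/msupp_exp_letter_sub[d1 s1]]]].
rewrite msuppU1 in_fset1 => /eqP -> ->.
rewrite fmM /wdeg map_cat sumn_cat size_cat -!/(wdeg _ _) d1; split=> //.
by rewrite -add2n leq_add2r.
Qed.

(** The excess of degree over length is nonnegative because letters have positive degree; f - id
    keeps the degree and increases the length, so it strictly lowers the excess. *)
Lemma exp_star_bijective : bijective (@exp_star k A deg br).
Proof.
apply: bijective_locally_unipotent => x.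
(* [n] strictly bounds the excess on the support of [x]; at [n = 0] the support must be empty. *)
have [n xn] : exists n, forall w, w \in msupp x -> (wdeg deg w < size w + n)%N.
  exists (\max_(w <- msupp x) wdeg deg w).+1 => w wx.
  rewrite addnS ltnS; apply: leq_trans (leq_addl _ _).
  exact: leq_bigmax_seq.
exists n; elim: n x xn => [|n IHn] x xn.
  apply/eqP; rewrite -msupp_eq0; apply/eqP/fsetP => w; rewrite in_fset0.
  apply/negP => /xn; rewrite addn0 ltnNge => /negP; apply.
  rewrite /wdeg -sum1_size sumnE big_map; exact: leq_sum.
rewrite iterSr; apply: IHn => v.
have xE : x = \sum_(w <- msupp x) x@_w *: << w >>.
  by rewrite [LHS]monalgE; apply: eq_bigr => w _; rewrite malgUZ.
have -> : exp_star deg br x - x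
        = \sum_(w <- msupp x) x@_w *: (exp_star deg br << w >> - << w >>).
  have fxE : exp_star deg br x
           = \sum_(w <- msupp x) x@_w *: exp_star deg br << w >>.
    rewrite {1}xE [LHS](linear_sum (@exp_star k A deg br)).
    by apply: eq_bigr => w _; apply: linearZ.
  rewrite fxE [X in _ - X]xE -[LHS]sumrB; apply: eq_bigr => w _.
  exact/esym/scalerBr.
rewrite -mcoeff_neq0 raddf_sum; apply: contraNT => vn.
rewrite big_seq big1 // => w wx.
rewrite [LHS]mcoeffZ [X in _ * X]mcoeff_outdom ?mulr0 //.
apply: (contraNN _ vn) => /msupp_exp_star_sub[-> wv].
by apply: (leq_trans (xn w wx)); rewrite addnS -addSn leq_add2r.
Qed.

Lemma exp_star_transpose : is_transpose (@qexp k A br) (exp_star deg br).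
Proof.
move=> u g; rewrite !pairingE [RHS]linear_linext; apply: (@eq_linext k W k^o) => v.
rewrite [RHS](pairingC (exp_word k br v) g) mcoeff_linext.
apply: (@eq_linext k W k^o) => w.
by rewrite -exp_starU (mcoeff_exp_star k deg_gt0 A_finite S0 S3).
Qed.

Lemma exp_star_comul x :
  dual_coprod (@shuffle k A) (exp_star deg br x)
  = tmap (exp_star deg br) (exp_star deg br)
      (dual_coprod (@quasi_shuffle k A br) x).
Proof.
have fM := exp_star_monoid_morphism k deg br.
have dM := comul_monoid_morphism k deg_gt0 A_finite S3.
have dsM := shuffle_comul_monoid_morphism k deg_gt0 A_finite.
move: x; pose f := @exp_star k A deg br.
apply: (free_malg_ext (f := dual_coprod (@shuffle k A) \o f)
  (g := tmap f f \o dual_coprod (@quasi_shuffle k A br))) => [||c].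
- exact: comp_monoid_morphism.
- by apply: comp_monoid_morphism dM; apply: tmap_monoid_morphism.
by rewrite [LHS]/= exp_star_letter exp_star_comul_letter.
Qed.

Theorem exp_star_hopf_isomorphism :
  hopf_isomorphism (dual_hopf (@quasi_shuffle k A br))
                   (dual_hopf (@shuffle k A)) (@exp_star k A deg br).
Proof.
pose H := dual_hopf (@quasi_shuffle k A br).
pose K := dual_hopf (@shuffle k A).
pose f := @exp_star k A deg br.
suff: hopf_isomorphism H K f by [].
have [f1 fM] := exp_star_monoid_morphism k deg br.
have hopfK : is_hopf_algebra K := shuffle_hopf_algebra k deg_gt0 A_finite.
have [[algK coalgK _ _] antK] := hopfK.
have f_mul t : f (hmul H t) = hmul K (tmap f f t).
  move: t; apply: (linear_malg_ext (f := f \o hmul H)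
                     (g := hmul K \o tmap f f)) => -[u v] /=.
  by rewrite [dual_conc _]dual_concU fM tmapU [RHS]dual_conc_tens.
have f_one : f (hone H) = hone K by rewrite /= /f malgU1 f1.
have f_comul x : hcomul K (f x) = tmap f f (hcomul H x) := exp_star_comul x.
have f_counit x : hcounit K (f x) = hcounit H x.
  (* The counit reads the coefficient at the empty word, which in f(w) is the coefficient of w in
     exp(1) = 1. *)
  move: x; apply: (linear_malg_ext (f := hcounit K \o f) (g := hcounit H)) => w.
  rewrite /= dual_counitE mone_nil (mcoeff_exp_star k deg_gt0 A_finite S0 S3).
  by rewrite exp_word_nil dual_counitU -malgU1 mcoeffU eq_sym.
have [g0 fK gK] := exp_star_bijective.
pose g : {linear {malg k[W]} -> {malg k[W]}} :=
  HB.pack g0 (GRing.isLinear.Build _ _ _ _ g0 (can2_linear fK gK)).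
have fgK : cancel f g := fK.
have gfK : cancel g f := gK.
(* Only the coalgebra axioms and the antipode are pulled back along [f]; the algebra axioms and the
   compatibilities are available directly for the quasi-shuffle dual. *)
have coalgH := is_coalgebra_transport f_comul f_counit fgK coalgK.
have antH := has_antipode_transport f_mul f_one f_comul f_counit fgK gfK antK.
have hopfH : is_hopf_algebra H.
  split; last exact: antH.
  split; [exact: dual_hopf_algebra | exact: coalgH | | exact: dual_hopf_counit].
  exact/dual_hopf_comul_mul/(comul_monoid_morphism k deg_gt0 A_finite S3).
split; [exact: hopfH | exact: hopfK | | exact: exp_star_bijective].
apply: (HopfMorphism f_mul f_one f_comul f_counit) => S T antS antT.
exact: (bialgebra_morphism_antipode f_mul f_one f_comul f_counit
          coalgH algK antS antT).
Qed.

End ExponentialIsomorphism.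

Theorem theorem4p1 (R : realType) (k : fieldType)
    (iota : {rmorphism k -> R[i]})
    (A : choiceType) (deg : A -> nat)
    (br : option A -> option A -> option A)
    (deg_gt0 : forall a : A, (0 < deg a)%N)
    (A_finite : forall n : nat, finite_set [set a : A | deg a = n])
    (S0 : forall x, br x None = None)
    (S1 : forall x y, br x y = br y x)
    (S2 : forall x y z, br (br x y) z = br x (br y z))
    (S3 : forall a b : A, br (Some a) (Some b) = None \/
            exists2 c : A, br (Some a) (Some b) = Some c
                         & deg c = (deg a + deg b)%N) :
  exists exp_star : {linear gdual k A -> gdual k A},
    is_transpose (@qexp k A br) exp_star /\
    hopf_isomorphism (dual_hopf (@quasi_shuffle k A br))
                     (dual_hopf (@shuffle k A)) exp_star.
Proof.
(* The embedding of [k] into the complex numbers forces characteristic 0. *)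
have fact_neq0 n : n`!%:R != 0 :> k.
  by rewrite -(fmorph_eq0 iota) rmorph_nat pnatr_eq0 -lt0n fact_gt0.
exists (@exp_star k A deg br); split.
  exact: exp_star_transpose.
exact: exp_star_hopf_isomorphism.
Qed.
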